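(* Let $J$ be a Jacobi matrix and let $E$ be an isolated eigenvalue of $J$ in $\mathbb{R}\setminus[-2,2]$. Let $\widetilde J$ be the Jacobi matrix obtained from $J$ by removing the eigenvalue $E$ by double commutation (defined in the context). Assume that the parameter sequences $b_n$, $a_n^2-1$ of $J$ and $\tilde b_n$, $\tilde a_n^2-1$ of $\widetilde J$ are conditionally summable, let $\lambda,\kappa$ and $\tilde\lambda,\tilde\kappa$ be the associated sequences of tail sums, and let $v$ and $\tilde v$ be the densities of the absolutely continuous parts of the spectral measures of $J$ and $\widetilde J$. Then (1) $\tilde\lambda,\tilde\kappa\in l^2_1$ if and only if $\lambda,\kappa\in l^2_1$; (2) $\tilde v\in\mathcal{W}$ if and only if $v\in\mathcal{W}$.
   Context: A Jacobi matrix is the semi-infinite tridiagonal self-adjoint matrix $J$ on $l^2(\mathbb{N})$, $\mathbb N=\{1,2,\dots\}$, with diagonal entries $b_n\in\mathbb{R}$ and off-diagonal entries $J_{n,n+1}=J_{n+1,n}=a_n>0$, $n\ge1$. Its spectral measure $d\nu$ is that of the pair $(J,\delta_1)$, $\delta_1=(1,0,0,\dots)^t$. Removal of an eigenvalue by double commutation: let $\phi=(\phi_n)_{n\ge0}$ satisfy $J\phi=E\phi$, $\phi_0=0$, $\phi_1=1$ (so $(\phi_n)_{n\ge1}$ is the eigenvector of $J$ for $E$), let $\gamma=-1/\|\phi\|_{l^2}^2$, and let $c_n=1+\gamma\sum_{j=1}^n|\phi_j|^2$ for $n\ge0$ (so $c_0=1$). Then $\widetilde J$ is the Jacobi matrix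 with parameters, for $n\ge1$, $$\tilde a_n=a_n\frac{\sqrt{c_{n-1}c_{n+1}}}{c_n},\qquad \tilde b_n=b_n+\gamma\Bigl(\frac{a_{n-1}\phi_{n-1}\phi_n}{c_{n-1}}-\frac{a_n\phi_n\phi_{n+1}}{c_n}\Bigr),$$ where for $n=1$ the term containing $\phi_0=0$ is zero. Tail sums: for $n=0,1,\dots$, $\lambda_n=-\sum_{k=n+1}^\infty b_k$ and $\kappa_n=-\sum_{k=n+1}^\infty(a_k^2-1)$; $\tilde\lambda_n,\tilde\kappa_n$ are defined in the same way from $\tilde b,\tilde a$. A sequence $\beta$ lies in $l^2_1$ if $\sum_n|n||\beta_n|^2<\infty$. A function $f$ on the unit circle $\partial\mathbb{D}$ lies in $\dot H^{1/2}(\partial\mathbb{D})$ if $\sum_{n\in\mathbb{Z}}|n||\hat f(n)|^2<\infty$; a function $f$ on $[-2,2]$ lies in $\dot H^{1/2}$ if $\theta\mapsto f(2\cos\theta)$ lies in $\dot H^{1/2}(\partial\mathbb{D})$. $v\in\mathcal{W}$ means that $v$ is supported in $[-2,2]$ and there has one of the four forms $(\sqrt{4-x^2})^{\pm1}v_0(x)$ or $\bigl(\sqrt{(2-x)/(2+x)}\bigr)^{\pm1}v_0(x)$ with $\log v_0\in\dot H^{1/2}$.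
   Formalization: The sign in the formula for b̃_n is corrected to b̃_n = b_n − γ(a_{n−1}φ_{n−1}φ_n/c_{n−1} − a_nφ_nφ_{n+1}/c_n); with the displayed plus sign E is not removed (a_n=1, b=(2,0,0,…), E=5/2 would give b̃=(7/2,0,0,…)). *)

(* Defs.v *)
From HB Require Import structures.
From mathcomp Require Import all_boot all_order all_algebra.
From mathcomp Require Import all_classical all_reals all_analysis.

Set Implicit Arguments.
Unset Strict Implicit.
Unset Printing Implicit Defensive.

Import Order.TTheory GRing.Theory Num.Theory.
Import numFieldNormedType.Exports.

Local Open Scope classical_set_scope.
Local Open Scope ring_scope.

(* Sequences are indexed as in the mathematics: N = {1, 2, ...}.  A vector of
   l^2(N) is a function on nat with value 0 at index 0, so that the recursion
   at site 1 needs no separate clause.  The values a 0 and b 0 are irrelevant.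
   Scalars are real: the entries of a Jacobi matrix are real, so its spectrum
   and the spectral measure of delta_1 are the same over R and over C. *)

Section Jacobi.
Variable R : realType.
Implicit Types (a b u w : R^nat) (x : R).

Definition l2 u : Prop :=
  u 0%N = 0 /\ cvgn (series (fun n => u n ^+ 2)).

Definition inner u w : R := limn (series (fun n => u n * w n)).

Definition delta1 : R^nat := fun n => (n == 1%N)%:R.

Definition jacobi a b u : R^nat := fun n =>
  if n is m.+1 then a m * u m + b m.+1 * u m.+1 + a m.+1 * u m.+2 else 0.

(* The maximal domain; it is all of l^2 when a and b are bounded. *)
Definition jacobi_dom a b u : Prop := l2 u /\ l2 (jacobi a b u).

Definition eigenvalue a b x : Prop :=
  exists u, [/\ jacobi_dom a b u, exists n, u n != 0
    & forall n, jacobi a b u n = x * u n].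

Definition resolvent_set a b : set R := [set x |
  (forall w, l2 w -> exists! u,
     jacobi_dom a b u /\ (forall n, jacobi a b u n - x * u n = w n)) /\
  (exists M : R, forall u, jacobi_dom a b u ->
     inner u u <= M * inner (fun n => jacobi a b u n - x * u n)
                            (fun n => jacobi a b u n - x * u n))].

Definition spectrum a b : set R := ~` resolvent_set a b.

Definition isolated_eigenvalue a b x : Prop :=
  eigenvalue a b x /\
  exists2 e : R, 0 < e &
    forall y, y != x -> `|y - x| < e -> ~ spectrum a b y.

Definition borel_measure := {measure set (measurableTypeR R) -> \bar R}.

(* P is the projection-valued measure of the Jacobi operator J, that is,
   J = \int x dP(x); mu u is the measure A |-> <u, P(A) u>, and its being a
   measure is the countable additivity of P.  By polarization, the last two
   clauses identify J with \int x dP(x), domains included. *)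
Record spectral_resolution a b (P : set (measurableTypeR R) -> R^nat -> R^nat)
    (mu : R^nat -> borel_measure) : Prop := {
  sr_l2 : forall A u, measurable A -> l2 u -> l2 (P A u) ;
  sr_linear : forall A (s : R) u w, measurable A -> l2 u -> l2 w ->
    P A (fun n => s * u n + w n) = (fun n => s * P A u n + P A w n) ;
  sr_sym : forall A u w, measurable A -> l2 u -> l2 w ->
    inner (P A u) w = inner u (P A w) ;
  sr_setT : forall u, l2 u -> P setT u = u ;
  sr_setI : forall A B u, measurable A -> measurable B -> l2 u ->
    P (A `&` B) u = P A (P B u) ;
  sr_measure : forall A u, measurable A -> l2 u ->
    mu u A = (inner u (P A u))%:E ;
  sr_dom : forall u, l2 u ->
    (jacobi_dom a b u <-> (\int[mu u]_x (x ^+ 2)%:E < +oo)%E) ;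
  sr_form : forall u, jacobi_dom a b u ->
    (\int[mu u]_x x%:E)%E = (inner u (jacobi a b u))%:E }.

Definition spectral_measure a b (nu : borel_measure) : Prop :=
  exists P mu, spectral_resolution a b P mu /\
    forall A, measurable A -> nu A = mu delta1 A.

(* Lebesgue decomposition dnu = v dx + dnus, with nus singular. *)
Definition ac_density (nu : borel_measure) (v : R -> R) : Prop :=
  [/\ measurable_fun [set: measurableTypeR R] v, forall x, 0 <= v x
    & exists nus : borel_measure,
      (exists N : set (measurableTypeR R), [/\ measurable N,
         lebesgue_measure N = 0%E & nus (~` N) = 0%E]) /\
      forall A : set (measurableTypeR R), measurable A ->
        nu A = (\int[lebesgue_measure]_(x in A) (v x)%:E + nus A)%E].

(* Double commutation at an eigenvalue, phi being the eigenvector with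
   phi_0 = 0 and phi_1 = 1.  With f_n = a_n phi_n phi_{n+1} / c_n, the new
   diagonal is b_n + gamma (f_n - f_{n-1}).  This sign is the one that removes
   the eigenvalue: as a_1 phi_2 = E - b_1, it gives
   btilde_1 = (b_1 + gamma E) / (1 + gamma), the mean of
   (nu + gamma delta_E) / (1 + gamma), where -gamma = nu {E}. *)
Definition dc_gamma (phi : R^nat) : R := - (inner phi phi)^-1.

Definition dc_c (phi : R^nat) : R^nat := fun n =>
  1 + dc_gamma phi * \sum_(1 <= j < n.+1) phi j ^+ 2.

Definition dc_a a (phi : R^nat) : R^nat := fun n =>
  a n * (Num.sqrt (dc_c phi n.-1 * dc_c phi n.+1) / dc_c phi n).

Definition dc_b a b (phi : R^nat) : R^nat := fun n =>
  b n - dc_gamma phi * (a n.-1 * phi n.-1 * phi n / dc_c phi n.-1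
                        - a n * phi n * phi n.+1 / dc_c phi n).

Definition cond_summable (beta : R^nat) : Prop :=
  cvgn (fun N => \sum_(1 <= k < N) beta k).

Definition tail_sum (beta : R^nat) : R^nat := fun n =>
  - limn (fun N => \sum_(n.+1 <= k < N) beta k).

Definition l2_1 (beta : R^nat) : Prop :=
  (\sum_(0 <= n <oo) (n%:R * beta n ^+ 2)%:E < +oo)%E.

(* A function on the circle is given by its values at e^{i theta}; the Fourier
   coefficient of a real f is fourier_cos f n - i fourier_sin f n. *)
Definition fourier_cos (f : R -> R) (n : int) : R :=
  (2 * pi)^-1 *
  \int[lebesgue_measure]_(t in `[- pi, pi]) (f t * cos (n%:~R * t)).

Definition fourier_sin (f : R -> R) (n : int) : R :=
  (2 * pi)^-1 *
  \int[lebesgue_measure]_(t in `[- pi, pi]) (f t * sin (n%:~R * t)).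

Definition Hhalf_circle (f : R -> R) : Prop :=
  lebesgue_measure.-integrable `[- pi, pi] (EFin \o f) /\
  (\esum_(n in [set: int])
     (`|n|%N%:R * (fourier_cos f n ^+ 2 + fourier_sin f n ^+ 2))%:E < +oo)%E.

Definition Hhalf_interval (f : R -> R) : Prop :=
  Hhalf_circle (fun t => f (2 * cos t)).

(* Densities are defined up to null sets, hence the almost-everywhere
   equality; ln is the logarithm only on positive reals. *)
Definition class_W (v : R -> R) : Prop :=
  exists v0 w : R -> R,
  [/\ forall x, -2 <= x <= 2 -> 0 < v0 x,
      Hhalf_interval (fun x => ln (v0 x)),
      [\/ w = (fun x => Num.sqrt (4 - x ^+ 2)),
          w = (fun x => (Num.sqrt (4 - x ^+ 2))^-1),
          w = (fun x => Num.sqrt ((2 - x) / (2 + x)))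
        | w = (fun x => (Num.sqrt ((2 - x) / (2 + x)))^-1)]
    & {ae lebesgue_measure, forall x : measurableTypeR R,
         v x = if -2 <= x <= 2 then w x * v0 x else 0}].

End Jacobi.

(* Main.v *)
Require Import Defs.
From mathcomp Require Import all_boot all_order all_algebra.
From mathcomp Require Import all_classical all_reals all_analysis.
From mathcomp Require Import measurable_realfun ring lra zify.
Set Implicit Arguments.
Unset Strict Implicit.
Unset Printing Implicit Defensive.
Import Order.TTheory GRing.Theory Num.Theory.
Import numFieldNormedType.Exports.
Local Open Scope classical_set_scope.
Local Open Scope ring_scope.

(* Write gamma, c_n for the constants of the double commutation,
   F_n = gamma a_n phi_n phi_{n+1} / c_n and E = rho + 1/rho with |rho| < 1.

   (1) The ratios s_n = a_n phi_{n+1} / phi_n satisfy a Riccati recursion that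
   contracts backward to rho.  The transformed equation has the growing solution
   phi_n / sqrt(c_{n-1} c_n), and its ratios st_n contract forward to 1/rho.
   Call a sequence x small if sum n x_n^2 is finite.  If the parameters of either
   matrix differ from those of the free one by small sequences, then s_n, st_n and
   c_n / c_{n-1} differ from their limits by small sequences, because the
   recursions are contractions.  Now bt_n - b_n = F_n - F_{n-1} with
   F_n = s_n - st_n, and the diagonal entries of Jt^2 - J^2 are H_n - H_{n-1},
   where H_n is a rational function of these ratios; the terms of Jt^2 - J^2 that
   do not come from at_n^2 - a_n^2 are products of two small sequences, whose tail
   sums are small.  So the tail sums of the parameters of the two matrices differ
   by small sequences.

   (2) The spectral measures satisfy nu = c_1 nut - gamma delta_E, so that
   v = c_1 vt almost everywhere, and multiplying by a constant only changes the
   zeroth Fourier coefficient of log v_0.  Both sides of the identity have bounded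
   support, and their moments agree: the moments of a spectral resolution are the
   entries <delta_1, J^k delta_1>, and the triangular matrix that expresses the
   transformed orthogonal polynomials in the original ones intertwines J and Jt. *)

(** * Square-summable sequences and bounded Jacobi matrices *)

Section L2.
Variable R : realType.
Implicit Types (u v w : R^nat).

Lemma l2_cvg_prod u w : l2 u -> l2 w -> cvgn (series (fun n => u n * w n)).
Proof.
move=> [_ cu] [_ cw]; apply: normed_cvg.
have h0 n : 0 <= u n ^+ 2 + w n ^+ 2 by rewrite addr_ge0 ?sqr_ge0.
have hle n : `|u n * w n| <= u n ^+ 2 + w n ^+ 2.
  rewrite -(real_normK (num_real (u n))) -(real_normK (num_real (w n))).
  rewrite normrM; have := sqr_ge0 (`|u n| - `|w n|).
  by have := mulr_ge0 (normr_ge0 (u n)) (normr_ge0 (w n)); nra.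
apply: (series_le_cvg (fun n => normr_ge0 _) h0 hle).
exact: is_cvg_seriesD.
Qed.

Lemma l2_lin (s : R) u w : l2 u -> l2 w -> l2 (fun n => s * u n + w n).
Proof.
move=> lu lw; split; first by rewrite lu.1 lw.1 mulr0 addr0.
have e : s ^+ 2 *: (fun n => u n ^+ 2) + (2 * s) *: (fun n => u n * w n)
    + (fun n => w n ^+ 2) = (fun n => (s * u n + w n) ^+ 2).
  apply/funext => n.
  change (s ^+ 2 * u n ^+ 2 + 2 * s * (u n * w n) + w n ^+ 2 = (s * u n + w n) ^+ 2).
  by ring.
rewrite -e; apply: is_cvg_seriesD; last exact: lw.2.
apply: is_cvg_seriesD; first by apply: is_cvg_seriesZ; exact: lu.2.
by apply: is_cvg_seriesZ; exact: l2_cvg_prod.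
Qed.

Lemma inner_lin (s : R) u v w : l2 u -> l2 v -> l2 w ->
  inner v (fun n => s * u n + w n) = s * inner v u + inner v w.
Proof.
move=> lu lv lw; rewrite /inner.
have cu := l2_cvg_prod lv lu; have cw := l2_cvg_prod lv lw.
have -> : (fun n => v n * (s * u n + w n)) = s *: (fun n => v n * u n) + (fun n => v n * w n).
  apply/funext => n.
  by change (v n * (s * u n + w n) = s * (v n * u n) + v n * w n); ring.
rewrite lim_seriesD; [|by apply: is_cvg_seriesZ|exact: cw].
by rewrite lim_seriesZ.
Qed.

Lemma inner_sym u w : inner u w = inner w u.
Proof. by congr (limn (series _)); apply/funext => n; rewrite mulrC. Qed.

Lemma inner_linl (s : R) u v w : l2 u -> l2 v -> l2 w ->
  inner (fun n => s * u n + w n) v = s * inner u v + inner w v.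
Proof. by move=> lu lv lw; rewrite inner_sym inner_lin// !(inner_sym v). Qed.

Lemma l2_partial_le u N : l2 u -> \sum_(0 <= n < N) u n ^+ 2 <= inner u u.
Proof.
move=> lu; have -> : \sum_(0 <= n < N) u n ^+ 2 = series (fun n => u n * u n) N.
  by apply: eq_bigr => n _; rewrite expr2.
apply: nondecreasing_cvgn_le; last exact: l2_cvg_prod.
by apply/nondecreasing_seqP => m; rewrite /series/= big_nat_recr//= lerDl -expr2 sqr_ge0.
Qed.

Lemma inner_ge0 u : l2 u -> 0 <= inner u u.
Proof. by move=> lu; have := l2_partial_le 0 lu; rewrite big_geq. Qed.

Lemma l2_of_bound u (C : R) : u 0%N = 0 ->
  (forall N, \sum_(0 <= n < N) u n ^+ 2 <= C) -> l2 u.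
Proof.
move=> u0 uC; split => //; apply: nondecreasing_is_cvgn.
  by apply/nondecreasing_seqP => m; rewrite /series/= big_nat_recr//= lerDl sqr_ge0.
by exists C => _ [n _ <-]; exact: uC.
Qed.

Definition delta (k : nat) : R^nat := fun n => (n == k)%:R.

Let series_delta k (f : R^nat) N : (k < N)%N ->
  series (fun n => delta k n * f n) N = f k.
Proof.
move=> kN; rewrite /series/= big_mkord (bigD1 (Ordinal kN))//= /delta eqxx mul1r.
rewrite big1 ?addr0// => i /negP ik; case: eqP => [e|]; last by rewrite mul0r.
by case: ik; apply/eqP/val_inj.
Qed.

Lemma inner_delta k u : inner (delta k) u = u k.
Proof.
apply/cvg_lim => //; apply: cvg_near_cst.
by exists k.+1 => // N /= kN; rewrite series_delta.
Qed.

Lemma l2_delta k : (0 < k)%N -> l2 (delta k).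
Proof.
move=> k0; split; first by rewrite /delta; case: k k0.
apply/cvg_ex; exists (delta k k); apply: cvg_near_cst; exists k.+1 => // N /= kN.
rewrite -(series_delta (delta k) kN); congr (series _ _).
Qed.

Lemma l2_cvg0 u : l2 u -> u @ \oo --> 0.
Proof.
case=> _ /cvg_series_cvg_0 h.
apply/cvgrPdist_lt => eps e0; move/cvgrPdist_lt: h => /(_ (eps ^+ 2) (exprn_gt0 _ e0)).
apply: filterS => n; rewrite !sub0r !normrN normrX => h.
by rewrite -(@ltr_pXn2r _ 2)// ?nnegrE ?ltW.
Qed.

Lemma l2_shift_le u N : l2 u -> \sum_(0 <= n < N) u n.+1 ^+ 2 <= inner u u.
Proof.
move=> lu; have := l2_partial_le N.+1 lu; rewrite big_nat_recl//= => h.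
by apply: le_trans h; rewrite lerDr sqr_ge0.
Qed.

(** * Bounded Jacobi matrices as symmetric operators *)

Section BoundedJacobi.
Variables (a b : R^nat) (M : R).
Hypothesis aM : forall n, (0 < n)%N -> `|a n| <= M.
Hypothesis bM : forall n, (0 < n)%N -> `|b n| <= M.

Let M0 : 0 <= M. Proof. exact: le_trans (aM (n := 1) isT). Qed.

(** The bound does not cover [a 0], but [a 0] only ever multiplies [u 0 = 0]. *)
Let ax n u : u 0%N = 0 -> `|a n * u n| <= M * `|u n|.
Proof.
move=> u0; case: n => [|n]; first by rewrite u0 mulr0 normr0 mulr0.
by rewrite normrM ler_wpM2r// aM.
Qed.

Lemma l2_jacobi u : l2 u -> l2 (jacobi a b u).
Proof.
(* One factor 3 comes from [(x + y + z)^2 <= 3 (x^2 + y^2 + z^2)], the other from the three shifted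
   sums of squares, each at most [inner u u]. *)
move=> lu; apply: (@l2_of_bound _ (9 * M ^+ 2 * inner u u)) => //.
suff h N : \sum_(0 <= n < N.+1) jacobi a b u n ^+ 2 <= 9 * M ^+ 2 * inner u u.
  by case=> [|N]; [rewrite big_geq// mulr_ge0 ?inner_ge0// mulr_ge0 ?sqr_ge0|exact: h].
rewrite big_nat_recl//= expr0n/= add0r.
apply: (@le_trans _ _ (\sum_(0 <= n < N) 3 * M ^+ 2 * (u n ^+ 2 + u n.+1 ^+ 2 + u n.+2 ^+ 2))).
  apply: ler_sum => n _.
  have h1 := ax n lu.1.
  have h2 : `|b n.+1 * u n.+1| <= M * `|u n.+1| by rewrite normrM ler_wpM2r// bM.
  set x := a n * u n in h1 *; set y := b _ * _ in h2 *.
  have h4 : `|a n.+1 * u n.+2| <= M * `|u n.+2| by rewrite normrM ler_wpM2r// aM.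
  set z := a n.+1 * u n.+2 in h4 *.
  have sq (p q : R) : `|p| <= M * `|q| -> p ^+ 2 <= M ^+ 2 * q ^+ 2.
    move=> pq; rewrite -(real_normK (num_real p)) -(real_normK (num_real q)) -exprMn.
    by rewrite ler_sqr ?nnegrE ?mulr_ge0.
  have := sq _ _ h1; have := sq _ _ h2; have := sq _ _ h4.
  by have := sqr_ge0 (x - y); have := sqr_ge0 (y - z); have := sqr_ge0 (x - z); nra.
rewrite -mulr_sumr.
have -> : 9 * M ^+ 2 * inner u u = 3 * M ^+ 2 * (3 * inner u u) by ring.
rewrite ler_wpM2l ?mulr_ge0 ?sqr_ge0// !big_split/=.
have := l2_partial_le N lu; have := l2_shift_le N lu.
have : \sum_(0 <= n < N) u n.+2 ^+ 2 <= inner u u.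
  have := l2_shift_le N.+1 lu; rewrite big_nat_recl//= => h; apply: le_trans h.
  by rewrite lerDr sqr_ge0.
lra.
Qed.

Lemma l2_jacobi_dom u : l2 u -> jacobi_dom a b u.
Proof. by move=> lu; split => //; exact: l2_jacobi. Qed.

(** Summation by parts leaves a single boundary term, [a N] times a Wronskian. It vanishes in the
    limit because [a] is bounded and square-summable sequences tend to 0. *)
Lemma jacobi_sym u w : l2 u -> l2 w ->
  inner u (jacobi a b w) = inner (jacobi a b u) w.
Proof.
move=> lu lw; have lJu := l2_jacobi lu; have lJw := l2_jacobi lw.
have green N : series (fun n => u n * jacobi a b w n) N.+1 -
    series (fun n => jacobi a b u n * w n) N.+1 =
    a N * (u N * w N.+1 - u N.+1 * w N).
  elim: N => [|N IH].
    by rewrite /series/= !big_nat1 lu.1 lw.1 /=; ring.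
  move: IH; rewrite /series/= => IH; rewrite big_nat_recr//= [X in _ - X]big_nat_recr//=.
  rewrite opprD addrACA IH; ring.
apply/eqP; rewrite -subr_eq0 /inner -limB; [|exact: l2_cvg_prod..].
apply/eqP/cvg_lim => //; rewrite -cvg_shiftS.
have h : (fun N => a N * (u N * w N.+1 - u N.+1 * w N)) @ \oo --> 0.
  have u0 := l2_cvg0 lu; have w0 := l2_cvg0 lw.
  have u0' := u0; have w0' := w0; rewrite -cvg_shiftS in u0'; rewrite -cvg_shiftS in w0'.
  have z : (fun N => M * (`|u N| * `|w N.+1| + `|u N.+1| * `|w N|)) @ \oo --> 0.
    suff : (fun N => M * (`|u N| * `|w N.+1| + `|u N.+1| * `|w N|)) @ \oo -->
        M * (`|0 : R| * `|0 : R| + `|0 : R| * `|0 : R|).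
      by rewrite normr0 !mul0r addr0 mulr0.
    by apply: cvgMr; apply: cvgD; apply: cvgM; apply: cvg_norm.
  have z' : (fun N => - (M * (`|u N| * `|w N.+1| + `|u N.+1| * `|w N|))) @ \oo --> 0.
    by rewrite -oppr0; apply: cvgN.
  apply: (squeeze_cvgr _ z' z); exists 1%N => // n /= n1.
  rewrite -ler_norml normrM; apply: ler_pM => //; first exact: aM.
  by rewrite (le_trans (ler_normB _ _))// !normrM.
apply: cvg_trans h; apply: near_eq_cvg; apply: nearW => N; exact/esym/green.
Qed.

(** This bound on the quadratic form later confines the spectral measures to a compact interval. *)
Lemma jacobi_bounded u : l2 u -> `|inner u (jacobi a b u)| <= 3 * M * inner u u.
Proof.
move=> lu; have c := l2_cvg_prod lu (l2_jacobi lu).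
have h N : `|series (fun n => u n * jacobi a b u n) N| <= 3 * M * inner u u.
  apply: le_trans (ler_norm_sum _ _ _) _.
  suff h N' : \sum_(0 <= n < N'.+1) `|u n * jacobi a b u n| <= 3 * M * inner u u.
    by case: N => [|N]; [rewrite big_geq// mulr_ge0 ?inner_ge0// mulr_ge0|exact: h].
  rewrite big_nat_recl//= mulr0 normr0 add0r.
  (* The weights [1/2], 2, [1/2] come from [2 |u_i u_j| <= u_i^2 + u_j^2], and they add up to 3. *)
  apply: (@le_trans _ _ (\sum_(0 <= n < N')
    M * (2^-1 * u n ^+ 2 + 2 * u n.+1 ^+ 2 + 2^-1 * u n.+2 ^+ 2))).
    apply: ler_sum => n _; rewrite normrM.
    have h1 := ax n lu.1.
    have h2 : `|b n.+1 * u n.+1| <= M * `|u n.+1| by rewrite normrM ler_wpM2r// bM.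
    have h4 : `|a n.+1 * u n.+2| <= M * `|u n.+2| by rewrite normrM ler_wpM2r// aM.
    have h5 : `|a n * u n + b n.+1 * u n.+1 + a n.+1 * u n.+2| <=
        M * (`|u n| + `|u n.+1| + `|u n.+2|).
      by have := ler_normD (a n * u n) (b n.+1 * u n.+1);
         have := ler_normD (a n * u n + b n.+1 * u n.+1) (a n.+1 * u n.+2); lra.
    apply: (le_trans (ler_wpM2l (normr_ge0 _) h5)).
    rewrite mulrCA ler_wpM2l//.
    rewrite -(real_normK (num_real (u n))) -(real_normK (num_real (u n.+1))).
    rewrite -(real_normK (num_real (u n.+2))).
    have := sqr_ge0 (`|u n| - `|u n.+1|); have := sqr_ge0 (`|u n.+2| - `|u n.+1|); nra.
  rewrite -mulr_sumr.
  have -> : 3 * M * inner u u = M * (3 * inner u u) by ring.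
  rewrite ler_wpM2l// !big_split/= -!mulr_sumr.
  have := l2_partial_le N' lu; have := l2_shift_le N' lu.
  have : \sum_(0 <= n < N') u n.+2 ^+ 2 <= inner u u.
    have := l2_shift_le N'.+1 lu; rewrite big_nat_recl//= => h; apply: le_trans h.
    by rewrite lerDr sqr_ge0.
  lra.
rewrite ler_norml; apply/andP; split.
  by apply: limr_ge => //; apply: nearW => N; have := h N; rewrite ler_norml => /andP[].
by apply: limr_le => //; apply: nearW => N; have := h N; rewrite ler_norml => /andP[].
Qed.

Variable C : R.

(** With [C = - l] and [l] below the support of the spectral measures, this operator corresponds to
    multiplication by [x - l], which is nonnegative there, so that its moments are integrals of
    nonnegative functions. *)
Definition shifted_jacobi u : R^nat := fun n => jacobi a b u n + C * u n.
Let K := shifted_jacobi.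

Lemma shifted_jacobiE u : K u = fun n => C * u n + jacobi a b u n.
Proof. by apply/funext => n; rewrite addrC. Qed.

Lemma l2_shifted u : l2 u -> l2 (K u).
Proof. by move=> lu; rewrite shifted_jacobiE; apply: l2_lin => //; exact: l2_jacobi. Qed.

Lemma inner_shifted u w : l2 u -> l2 w ->
  inner u (K w) = C * inner u w + inner u (jacobi a b w).
Proof. by move=> lu lw; rewrite shifted_jacobiE inner_lin//; exact: l2_jacobi. Qed.

Lemma shifted_sym u w : l2 u -> l2 w -> inner u (K w) = inner (K u) w.
Proof.
move=> lu lw; rewrite inner_shifted// jacobi_sym// (inner_sym (K u)) inner_shifted//.
by rewrite (inner_sym w u) (inner_sym w).
Qed.

Lemma shifted_lin (s : R) u w :
  K (fun n => s * u n + w n) = fun n => s * K u n + K w n.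
Proof.
by apply/funext => -[|n]; rewrite /K /shifted_jacobi /=; ring.
Qed.

Lemma shifted_polar u w : l2 u -> l2 w ->
  inner (fun n => 1 * u n + w n) (K (fun n => 1 * u n + w n)) =
  inner u (K u) + 2 * inner u (K w) + inner w (K w).
Proof.
move=> lu lw; have lKu := l2_shifted lu; have lKw := l2_shifted lw.
have e : inner w (K u) = inner u (K w) by rewrite (shifted_sym lw lu) inner_sym.
rewrite shifted_lin inner_lin//; last exact: l2_lin.
by rewrite !inner_linl// e; ring.
Qed.

End BoundedJacobi.
End L2.

(** * Sequences with a weighted square sum *)

Section WeightedSquareSummable.
Variable R : realType.
Implicit Types (f g u w x y e p : R^nat).

(** Upper bounds on finite sums replace the convergence of series, so that estimates can be proved
    by induction on [N]. *)
Definition bounded_sums f := exists C, forall N, \sum_(0 <= n < N) f n <= C.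

Definition sq1 u := bounded_sums (fun n => n%:R * u n ^+ 2).

Lemma bounded_sums_dom f g : (forall n, 0 <= g n) ->
  (\forall n \near \oo, f n <= g n) -> bounded_sums g -> bounded_sums f.
Proof.
move=> g0 [N0 _ fg] [C gC]; exists (C + \sum_(0 <= n < N0) `|f n|) => N.
(* The terms from [N0] on are compared with [g]; the finitely many earlier ones go into the
   constant. *)
have H : \sum_(0 <= n < N) f n <=
    \sum_(0 <= n < N) g n + \sum_(0 <= n < minn N N0) `|f n|.
  elim: N => [|N IH]; first by rewrite min0n !big_geq // addr0.
  rewrite !big_nat_recr //=.
  have [NN|NN] := leqP N0 N.
    have -> : minn N.+1 N0 = minn N N0 by lia.
    by have := fg N NN; lra.
  have -> : minn N.+1 N0 = (minn N N0).+1 by lia.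
  rewrite big_nat_recr //=; have -> : minn N N0 = N by lia.
  have e : minn N N0 = N by lia.
  rewrite e in IH; by have := ler_norm (f N); have := g0 N; lra.
apply: le_trans H _; apply: lerD => //.
have h : (minn N N0 <= N0)%N by lia.
by rewrite (@big_cat_nat _ _ _ (minn N N0) 0 N0) //= lerDl sumr_ge0.
Qed.

Lemma bounded_sumsD f g :
  bounded_sums f -> bounded_sums g -> bounded_sums (fun n => f n + g n).
Proof.
by move=> [C fC] [D gD]; exists (C + D) => N; rewrite big_split /= lerD.
Qed.

Lemma bounded_sumsM (c : R) f : 0 <= c ->
  bounded_sums f -> bounded_sums (fun n => c * f n).
Proof.
by move=> c0 [C fC]; exists (c * C) => N; rewrite -mulr_sumr ler_wpM2l.
Qed.

Lemma bounded_sumsS f :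
  bounded_sums (fun n => f n.+1) <-> bounded_sums f.
Proof.
split=> -[C fC].
  exists (Num.max 0 (f 0%N + C)) => -[|N]; first by rewrite big_geq// le_max lexx.
  by rewrite big_nat_recl //= le_max lerD2l fC orbT.
by exists (C - f 0%N) => N; have := fC N.+1; rewrite big_nat_recl //=; lra.
Qed.

Lemma sq1_ge0 u n : 0 <= n%:R * u n ^+ 2.
Proof. by rewrite mulr_ge0 ?sqr_ge0. Qed.

Lemma l2_1P u : l2_1 u <-> sq1 u.
Proof.
have nn : forall n : nat, (0 <= n)%N -> true -> (0 <= (n%:R * u n ^+ 2)%:E)%E.
  by move=> n _ _; rewrite lee_fin sq1_ge0.
split=> [H|[C H]].
  have fi : (\sum_(0 <= n <oo) (n%:R * u n ^+ 2)%:E)%E \is a fin_num.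
    by rewrite ge0_fin_numE ?H// nneseries_ge0.
  exists (fine (\sum_(0 <= n <oo) (n%:R * u n ^+ 2)%:E)%E) => N.
  rewrite -lee_fin fineK// -sumEFin.
  exact: nneseries_lim_ge.
apply: (@le_lt_trans _ _ C%:E); last exact: ltry.
apply: lime_le; first exact: is_cvg_nneseries.
by apply: nearW => N; rewrite sumEFin lee_fin.
Qed.

Lemma sq1_dom (C : R) x y : sq1 y ->
  (\forall n \near \oo, `|x n| <= C * `|y n|) -> sq1 x.
Proof.
move=> sy xy; apply: (@bounded_sums_dom _ (fun n => C ^+ 2 * (n%:R * y n ^+ 2))).
- by move=> n; rewrite mulr_ge0 ?sqr_ge0 ?sq1_ge0.
- apply: filterS xy => n xy.
  have -> : C ^+ 2 * (n%:R * y n ^+ 2) = n%:R * (C * `|y n|) ^+ 2.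
    by rewrite exprMn real_normK ?num_real//; ring.
  rewrite ler_wpM2l// -[x n ^+ 2]real_normK ?num_real//.
  by rewrite ler_sqr ?nnegrE// (le_trans _ xy).
- by apply: bounded_sumsM; rewrite ?sqr_ge0.
Qed.

Lemma sq1_eq x y : sq1 y -> (\forall n \near \oo, x n = y n) -> sq1 x.
Proof.
by move=> sy xy; apply: (@sq1_dom 1 _ _ sy); apply: filterS xy => n ->; rewrite mul1r.
Qed.

Lemma sq1D x y : sq1 x -> sq1 y -> sq1 (fun n => x n + y n).
Proof.
move=> sx sy.
apply: (@bounded_sums_dom _ (fun n => 2 * (n%:R * x n ^+ 2) + 2 * (n%:R * y n ^+ 2))).
- by move=> n; rewrite addr_ge0// mulr_ge0// sq1_ge0.
- apply: nearW => n; have := ler0n R n; have := sqr_ge0 (x n - y n); nra.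
- by apply: bounded_sumsD; apply: bounded_sumsM.
Qed.

Lemma sq1Z (c : R) x : sq1 x -> sq1 (fun n => c * x n).
Proof.
by move=> sx; apply: (@sq1_dom `|c| _ _ sx); apply: nearW => n; rewrite normrM.
Qed.

Lemma sq1B x y : sq1 x -> sq1 y -> sq1 (fun n => x n - y n).
Proof.
move=> sx sy; apply: sq1D => //; apply: (@sq1_dom 1 _ _ sy).
by apply: nearW => n; rewrite normrN mul1r.
Qed.

Lemma sq1M (C : R) k x : (\forall n \near \oo, `|k n| <= C) -> sq1 x ->
  sq1 (fun n => k n * x n).
Proof.
move=> kC sx; apply: (@sq1_dom C _ _ sx); apply: filterS kC => n kC.
by rewrite normrM ler_wpM2r.
Qed.

(** Up to finitely many terms, the weights [n] and [n + 1] are comparable. *)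
Lemma sq1S x : sq1 (fun n => x n.+1) <-> sq1 x.
Proof.
split=> sx.
  apply: (iffLR (bounded_sumsS _)).
  apply: (@bounded_sums_dom _ (fun n => 2 * (n%:R * x n.+1 ^+ 2))).
  - by move=> n; rewrite mulr_ge0// mulr_ge0// sqr_ge0.
  - exists 1%N => // n /= n1; rewrite mulrA ler_wpM2r ?sqr_ge0//.
    by rewrite -natrM ler_nat; lia.
  - exact: bounded_sumsM.
apply: (@bounded_sums_dom _ (fun n => (n.+1%:R * x n.+1 ^+ 2))).
- by move=> n; rewrite mulr_ge0// sqr_ge0.
- by apply: nearW => n; rewrite ler_wpM2r ?sqr_ge0// ler_nat.
- exact: (iffRL (bounded_sumsS (fun n => n%:R * x n ^+ 2)) sx).
Qed.

Lemma sq1_cvg0 x : sq1 x -> x @ \oo --> 0.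
Proof.
move=> [C sC]; have cs : cvgn (series (fun n => n%:R * x n ^+ 2)).
  apply: nondecreasing_is_cvgn.
    apply/nondecreasing_seqP => n; rewrite /series /= big_nat_recr //= lerDl.
    exact: sq1_ge0.
  by exists C => _ [n _ <-]; exact: sC.
have c0 := cvg_series_cvg_0 cs.
apply/cvgrPdist_lt => eps e0; move/cvgrPdist_lt: c0 => /(_ (eps ^+ 2) (exprn_gt0 _ e0)).
move=> -[N _ HN]; exists N.+1 => // n /= Nn.
have := HN n (ltnW Nn); rewrite !sub0r !normrN ger0_norm ?sq1_ge0// => H.
rewrite -(@ltr_pXn2r _ 2)// ?nnegrE ?ltW// real_normK ?num_real//.
apply: le_lt_trans H; rewrite ler_peMl ?sqr_ge0// ler1n; lia.
Qed.

(** Convexity of the square, for the points [s] and [t / (1 - k)] with weights [k] and [1 - k]. *)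
Lemma sqr_contraction (k s t : R) : 0 <= k < 1 ->
  (k * s + t) ^+ 2 <= k * s ^+ 2 + (1 - k)^-1 * t ^+ 2.
Proof.
move=> /andP[k0 k1].
have h : 0 < 1 - k by lra.
have -> : k * s ^+ 2 + (1 - k)^-1 * t ^+ 2 =
   (k * s + t) ^+ 2 + k * (1 - k)^-1 * ((1 - k) * s - t) ^+ 2.
  by field; lra.
by rewrite lerDl mulr_ge0// ?sqr_ge0// mulr_ge0// invr_ge0 ltW.
Qed.

(** Once the growth of the weight from [n] to [n + 1] is absorbed, [n x_n^2] obeys a linear
    recursion with a factor below 1; summing it bounds the sum by that factor times itself plus a
    constant. *)
Lemma sq1_forward (k : R) x e : 0 <= k < 1 -> sq1 e ->
  (\forall n \near \oo, `|x n.+1| <= k * `|x n| + `|e n|) -> sq1 x.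
Proof.
move=> k01 se [N0 _ H]; have /andP[k0 k1] := k01.
(* Halfway between [k] and 1. The inequality [k (n + 1) <= m n] holds from [n = k / (m - k)] on,
   which is where [q] and [N1] come from. *)
pose m := (1 + k) / 2.
have m1 : 0 <= m < 1 by rewrite /m; lra.
have km : k <= m by rewrite /m; lra.
have mk : k < m by rewrite /m; lra.
pose q := k / (m - k).
have q0 : 0 <= q by rewrite divr_ge0// subr_ge0.
have [N1 N01 qN1] : exists2 N1, (N0 < N1)%N & q <= N1%:R.
  exists (N0 + Num.Def.archi_bound q).+1; first by rewrite ltnS leq_addr.
  by rewrite (le_trans (ltW (archi_boundP q0)))// ler_nat leqW// leq_addl.
have kq n : (N1 <= n)%N -> k * n.+1%:R <= m * n%:R.
  move=> Nn; have : q <= n%:R by apply: (le_trans qN1); rewrite ler_nat.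
  rewrite /q ler_pdivrMr; last by lra.
  by rewrite -[n.+1]addn1 natrD; lra.
have [C eC] : bounded_sums (fun n => (1 - k)^-1 * (2 * (n%:R * e n ^+ 2))).
  by apply: bounded_sumsM; [rewrite invr_ge0; lra|apply: bounded_sumsM].
have C0 : 0 <= C by have := eC 0%N; rewrite big_geq.
pose y n := n%:R * x n ^+ 2.
have y0 n : 0 <= y n by exact: sq1_ge0.
have st n : (N1 <= n)%N ->
    y n.+1 <= m * y n + (1 - k)^-1 * (2 * (n%:R * e n ^+ 2)).
  move=> Nn; rewrite /y.
  have hn : (N0 <= n)%N by exact: leq_trans (ltnW N01) Nn.
  have h1 : x n.+1 ^+ 2 <= k * x n ^+ 2 + (1 - k)^-1 * e n ^+ 2.
    have := sqr_contraction `|x n| `|e n| k01.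
    rewrite !real_normK ?num_real//; apply: le_trans.
    by rewrite -real_normK ?num_real// ler_sqr ?nnegrE ?addr_ge0 ?mulr_ge0// H.
  have h2 : n.+1%:R * x n.+1 ^+ 2 <= n.+1%:R * (k * x n ^+ 2 + (1 - k)^-1 * e n ^+ 2).
    by rewrite ler_wpM2l.
  apply: (le_trans h2); rewrite mulrDr lerD//.
    have := kq n Nn; have := sqr_ge0 (x n); nra.
  have k2 : 0 <= (1 - k)^-1 by rewrite invr_ge0; lra.
  rewrite mulrCA ler_wpM2l//.
  rewrite mulrA ler_wpM2r ?sqr_ge0// -natrM ler_nat mulSnr mul1n -addn1 leq_add2l.
  exact: leq_trans (leq_trans _ N01) Nn.
(* The terms before [N1] are masked, so that the recursion is available from the first counted term
   on, with [y N1] as initial value. *)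
have B N : \sum_(0 <= n < N) y n * (N1 <= n)%:R <= (C + y N1) / (1 - m).
  rewrite ler_pdivlMr; last by lra.
  have : \sum_(0 <= n < N) y n * (N1 <= n)%:R <=
     m * (\sum_(0 <= n < N) y n * (N1 <= n)%:R) + C + y N1.
    suff : \sum_(0 <= n < N) y n * (N1 <= n)%:R <=
     m * (\sum_(0 <= n < N.-1) y n * (N1 <= n)%:R) +
      \sum_(0 <= n < N.-1) (1 - k)^-1 * (2 * (n%:R * e n ^+ 2)) + (N1 < N)%:R * y N1.
      have h := eC N.-1.
      have h1 : \sum_(0 <= n < N.-1) y n * (N1 <= n)%:R <= \sum_(0 <= n < N) y n * (N1 <= n)%:R.
        case: N {h} => [|N]; first by rewrite !big_geq.
        by rewrite big_nat_recr //= lerDl mulr_ge0.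
      have h2 : (N1 < N)%:R * y N1 <= y N1 by rewrite ler_piMl // lern1 leq_b1.
      have h3 : m * (\sum_(0 <= n < N.-1) y n * (N1 <= n)%:R) <=
          m * \sum_(0 <= n < N) y n * (N1 <= n)%:R.
        by rewrite ler_wpM2l//; lra.
      lra.
    elim: N => [|[|N] IH]; first by rewrite !big_geq // mulr0 !mul0r !addr0.
      have z0 : y 0%N = 0 by rewrite /y mul0r.
      by rewrite big_nat1 !big_geq// z0 mul0r mulr0 !add0r mulr_ge0.
    rewrite big_nat_recr //= [X in m * X]big_nat_recr //= [X in _ + X + _]big_nat_recr //=.
    move: IH => /= IH.
    have e0 n : 0 <= (1 - k)^-1 * (2 * (n%:R * e n ^+ 2)).
      by rewrite mulr_ge0 ?invr_ge0//; [lra|rewrite mulr_ge0// sq1_ge0].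
    have [h|h|h] := ltngtP N1 N.+1.
    - have -> : (N1 < N.+2)%N by exact: leqW h.
      rewrite h mul1r in IH; have -> : (N1 <= N)%N by exact: h.
      by rewrite !mulr1 mul1r; have := st N h; lra.
    - have -> : (N1 < N.+2)%N = false by rewrite ltnS leqNgt h.
      have -> : (N1 <= N)%N = false by rewrite leqNgt (ltnW h).
      have eN : (N1 < N.+1)%N = false by rewrite ltnNge (ltnW h).
      rewrite eN in IH.
      rewrite mul0r addr0 in IH; rewrite !mulr0 mul0r !addr0; have := e0 N; lra.
    - have -> : (N1 < N.+2)%N by rewrite h.
      have -> : (N1 <= N)%N = false by rewrite h ltnn.
      have eN : (N1 < N.+1)%N = false by rewrite h ltnn.
      rewrite eN in IH.
      rewrite mul0r addr0 in IH; rewrite -h in IH *.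
      rewrite mulr0 !addr0 mulr1 mul1r; have := e0 N; lra.
  lra.
apply: (@bounded_sums_dom _ (fun n => y n * (N1 <= n)%:R)).
- by move=> n; rewrite mulr_ge0.
- by exists N1 => // n /= ->; rewrite mulr1.
- by eexists => N; exact: B.
Qed.

(** Iterating [J] steps bounds [x n] by [k^J] times the bound on [x] plus a geometric sum of late
    errors, and each of the two is at most half of [eps]. *)
Lemma backward_cvg0 (k B : R) x e : 0 <= k < 1 -> e @ \oo --> 0 ->
  (\forall n \near \oo, `|x n| <= B) ->
  (\forall n \near \oo, `|x n| <= k * `|x n.+1| + `|e n|) -> x @ \oo --> 0.
Proof.
move=> /andP[k0 k1] e0 [N1 _ xB] [N2 _ H].
apply/cvgrPdist_lt => eps eps0.
have d0 : 0 < eps * (1 - k) / 2 by rewrite divr_gt0// mulr_gt0//; lra.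
move/cvgrPdist_lt: e0 => /(_ _ d0); move=> -[N3 _ He].
have : `|k| < 1 by rewrite ger0_norm.
move/cvg_expr => /cvgrPdist_lt.
have q0 : 0 < eps / 2 / (`|B| + 1) by rewrite divr_gt0// ?divr_gt0// ltr_wpDl.
move/(_ _ q0); move=> -[J _ HJ].
exists (N1 + N2 + N3)%N => // n /= Nn; rewrite sub0r normrN.
(* The term [(1 - k^j) eps / 2] is the geometric sum of the errors [eps (1 - k) / 2]. *)
have it j : `|x n| <= k ^+ j * `|x (n + j)%N| + (eps / 2) * (1 - k ^+ j).
  elim: j => [|j IH]; first by rewrite expr0 addn0 mul1r subrr mulr0 addr0.
  apply: (le_trans IH); rewrite addnS.
  have h1 := H (n + j)%N ltac:(rewrite /=; lia).
  have h2 : `|e (n + j)%N| <= eps * (1 - k) / 2.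
    by have := He (n + j)%N ltac:(rewrite /=; lia); rewrite sub0r normrN => /ltW.
  have h3 : k ^+ j * `|x (n + j)%N| <=
      k ^+ j * (k * `|x (n + j).+1| + eps * (1 - k) / 2).
    by rewrite ler_wpM2l ?exprn_ge0//; lra.
  rewrite exprS; move: h3; set A := `|x (n + j).+1|; set K := k ^+ j; lra.
apply: (le_lt_trans (it J)).
have h := HJ J (leqnn J); rewrite sub0r normrN ger0_norm ?exprn_ge0// in h.
have xb : `|x (n + J)%N| <= `|B| + 1.
  have := xB (n + J)%N ltac:(rewrite /=; lia); have := ler_norm B; lra.
rewrite ltr_pdivlMr in h; last by have := normr_ge0 B; lra.
have h4 : k ^+ J * `|x (n + J)%N| <= k ^+ J * (`|B| + 1).
  by rewrite ler_wpM2l ?exprn_ge0.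
have h5 : eps / 2 * (1 - k ^+ J) <= eps / 2.
  have := mulr_ge0 (ltW eps0) (exprn_ge0 J k0); lra.
lra.
Qed.

(* The truncated weight min(n, M) is needed because n x_n^2 is not yet known to
   be bounded. *)
Lemma sq1_backward (k : R) x e : 0 <= k < 1 -> sq1 e -> x @ \oo --> 0 ->
  (\forall n \near \oo, `|x n| <= k * `|x n.+1| + `|e n|) -> sq1 x.
Proof.
move=> k01 se x0 H; have /andP[k0 k1] := k01.
(* Only the positive part of [z] is estimated, so that it can be given any weight between 0 and
   [n]. *)
pose z n := x n ^+ 2 - k * x n.+1 ^+ 2.
have [C zC] : bounded_sums (fun n => n%:R * Num.max 0 (z n)).
  apply: (@bounded_sums_dom _ (fun n => (1 - k)^-1 * (n%:R * e n ^+ 2))).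
  - by move=> n; rewrite mulr_ge0 ?invr_ge0 ?sq1_ge0//; lra.
  - apply: filterS H => n H; rewrite mulrCA ler_wpM2l//.
    have k2 : 0 <= (1 - k)^-1 by rewrite invr_ge0; lra.
    rewrite ge_max mulr_ge0 ?sqr_ge0//=.
    have := sqr_contraction `|x n.+1| `|e n| k01.
    rewrite !real_normK ?num_real// /z => h.
    suff : x n ^+ 2 <= (k * `|x n.+1| + `|e n|) ^+ 2 by lra.
    by rewrite -real_normK ?num_real// ler_sqr ?nnegrE ?addr_ge0 ?mulr_ge0.
  - by apply: bounded_sumsM; rewrite ?invr_ge0//; lra.
exists ((C + 1) / (1 - k)) => M.
(* The threshold depends on the truncation level [M]. Beyond it the boundary term of the summation,
   whose weight is at most [M], is at most 1. *)
have [N0 _ HN] : \forall n \near \oo, M%:R * x n ^+ 2 <= 1.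
  move/cvgrPdist_lt: x0 => /(_ (M%:R + 1)^-1).
  rewrite invr_gt0 ltr_wpDl// => /(_ isT); apply: filterS => n.
  rewrite sub0r normrN => h.
  have M1 : 1 <= M%:R + 1 :> R by rewrite lerDr.
  have h1 : `|x n| ^+ 2 <= ((M%:R + 1)^-1) ^+ 2.
    by rewrite ler_sqr ?nnegrE ?invr_ge0//; exact: ltW.
  rewrite real_normK ?num_real// in h1.
  apply: (@le_trans _ _ (M%:R * ((M%:R + 1)^-1) ^+ 2)); first by rewrite ler_wpM2l.
  rewrite exprVn ler_pdivrMr; last by rewrite exprn_gt0// ltr_wpDl.
  rewrite mul1r; have := ler0n R M; nra.
pose om n : R := (minn n M)%:R.
have om0 n : 0 <= om n by [].
have omS n : om n <= om n.+1 by rewrite ler_nat; lia.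
have S N : \sum_(0 <= n < N) om n * x n ^+ 2 <=
    k * (\sum_(0 <= n < N) om n * x n ^+ 2) + k * (om N * x N ^+ 2) +
    \sum_(0 <= n < N) n%:R * Num.max 0 (z n).
  elim: N => [|N IH]; first by rewrite !big_geq// /om min0n mul0r !mulr0 !addr0.
  rewrite !big_nat_recr //=.
  have a1 : om N * x N ^+ 2 <= k * (om N.+1 * x N.+1 ^+ 2) + N%:R * Num.max 0 (z N).
    have b1 : om N * (k * x N.+1 ^+ 2) <= om N.+1 * (k * x N.+1 ^+ 2).
      by rewrite ler_wpM2r// mulr_ge0 ?sqr_ge0.
    have b2 : om N * z N <= N%:R * Num.max 0 (z N).
      apply: (@le_trans _ _ (om N * Num.max 0 (z N))).
        by rewrite ler_wpM2l// le_max lexx orbT.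
      by rewrite ler_wpM2r ?le_max ?lexx// ler_nat; lia.
    rewrite /z in b2 *; lra.
  lra.
pose N := (M + N0)%N.
have h1 : \sum_(0 <= n < M) n%:R * x n ^+ 2 <= \sum_(0 <= n < N) om n * x n ^+ 2.
  have MN : (M <= N)%N by rewrite /N; lia.
  rewrite (@big_cat_nat _ _ _ M 0 N) //= ler_wpDr ?sumr_ge0//.
    by move=> n _; rewrite mulr_ge0 ?sqr_ge0.
  rewrite big_nat [leRHS]big_nat; apply: ler_sum => n /andP[_ nM].
  by rewrite ler_wpM2r ?sqr_ge0// ler_nat; lia.
apply: (le_trans h1); rewrite ler_pdivlMr; last by lra.
have h2 : om N * x N ^+ 2 <= 1.
  have -> : om N = M%:R by rewrite /om; congr (_%:R); rewrite /N; lia.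
  by apply: HN; rewrite /N /=; lia.
have h3 : k * (om N * x N ^+ 2) <= 1.
  apply: (le_trans _ h2); rewrite ler_piMl//; last by lra.
  by rewrite mulr_ge0 ?sqr_ge0.
have := S N; have := zC N; lra.
Qed.

(** Summing backward gives [n |x_n| <= \sum_(i >= n) i |d_i e_i|] for large [n], which is at most a
    constant [C]. Abel summation then bounds the sums of [|x_n|], and [n x_n^2 <= C |x_n|]. *)
Lemma sq1_prod_tail x d e : sq1 d -> sq1 e -> x @ \oo --> 0 ->
  (\forall n \near \oo, x n - x n.+1 = d n * e n) -> sq1 x.
Proof.
move=> sd se x0 [N0 _ H].
have [C pC] : bounded_sums (fun n => n%:R * `|d n * e n|).
  apply: (@bounded_sums_dom _ (fun n => n%:R * d n ^+ 2 + n%:R * e n ^+ 2)).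
  - by move=> n; rewrite addr_ge0// sq1_ge0.
  - apply: nearW => n; rewrite -mulrDr ler_wpM2l// normrM.
    have := sqr_ge0 (`|d n| - `|e n|); have := sqr_ge0 (`|d n| + `|e n|).
    rewrite -(real_normK (num_real (d n))) -(real_normK (num_real (e n))).
    by nra.
  - exact: bounded_sumsD.
have C0 : 0 <= C by have := pC 0%N; rewrite big_geq.
have st n j : (N0 <= n)%N -> n%:R * `|x n| <= n%:R * `|x (n + j)%N| +
    \sum_(n <= i < (n + j)%N) i%:R * `|d i * e i|.
  move=> Nn; elim: j => [|j IH]; first by rewrite addn0 big_geq// addr0.
  apply: (le_trans IH); rewrite addnS big_nat_recr /=; last by lia.
  have : `|x (n + j)%N| <= `|x (n + j).+1| + `|d (n + j)%N * e (n + j)%N|.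
    rewrite -(H (n + j)%N) /=; last by lia.
    by have := ler_normD (x (n + j)%N - x (n + j).+1) (x (n + j).+1); rewrite subrK; lra.
  move/(ler_wpM2l (ler0n R n)).
  have : n%:R * `|d (n + j)%N * e (n + j)%N| <= (n + j)%:R * `|d (n + j)%N * e (n + j)%N|.
    by rewrite ler_wpM2r// ler_nat; lia.
  lra.
have xC n : (N0 <= n)%N -> n%:R * `|x n| <= C.
  move=> Nn; apply/ler_addgt0Pr => eps e0.
  move/cvgrPdist_lt: x0 => /(_ (eps / (n%:R + 1))).
  rewrite divr_gt0 ?ltr_wpDl// => /(_ isT); move=> -[J _ HJ].
  have := HJ (n + J)%N ltac:(rewrite /=; lia); rewrite sub0r normrN.
  rewrite ltr_pdivlMr ?ltr_wpDl// => h.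
  have := st n J Nn.
  have : \sum_(n <= i < (n + J)%N) i%:R * `|d i * e i| <= C.
    apply: le_trans (pC (n + J)%N); rewrite (@big_cat_nat _ _ _ n 0 (n + J))//=; last by lia.
    by rewrite lerDr sumr_ge0// => i _; rewrite mulr_ge0.
  by have := normr_ge0 (x (n + J)%N); lra.
have [D xD] : bounded_sums (fun n => `|x n|).
  apply: (iffLR (bounded_sumsS _)).
  apply: (@bounded_sums_dom _ (fun n => (N0 <= n)%:R * `|x n.+1|)).
  - by move=> n; rewrite mulr_ge0.
  - by exists N0 => // n /= ->; rewrite mul1r.
  exists (C + C) => N.
  (* For [n >= N0], passing from [n] to [n + 1] raises [n |x_n|] by at least
     [|x_(n+1)| - n |d_n e_n|]. *)
  have h : \sum_(0 <= n < N) (N0 <= n)%:R * `|x n.+1| <=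
      (N0 <= N)%:R * (N%:R * `|x N|) + \sum_(0 <= n < N) n%:R * `|d n * e n|.
    elim: N => [|N IH]; first by rewrite !big_geq// mul0r mulr0 addr0.
    rewrite !big_nat_recr //=; move: IH.
    set A := \sum_(0 <= n < N) _; set B := \sum_(0 <= n < N) _ => IH.
    have p0 : 0 <= N%:R * `|d N * e N| by rewrite mulr_ge0.
    have [h|h] := leqP N0 N; last first.
      rewrite mul0r addr0; rewrite leqNgt h mul0r /= in IH.
      have : 0 <= (N0 <= N.+1)%:R * (N.+1%:R * `|x N.+1|) by rewrite !mulr_ge0.
      by lra.
    rewrite h mul1r in IH; have -> : (N0 <= N.+1)%N by lia.
    have := st N 1%N h; rewrite addn1 big_nat1 -[N.+1]addn1 natrD; rewrite !mul1r; lra.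
  apply: (le_trans h); apply: lerD => //.
  by have [hN|hN] := leqP N0 N; [rewrite mul1r xC|rewrite mul0r].
apply: (@bounded_sums_dom _ (fun n => C * `|x n|)).
- by move=> n; rewrite mulr_ge0.
- exists N0 => // n /= Nn; rewrite -real_normK ?num_real// expr2 mulrA.
  by rewrite ler_wpM2r// xC.
- by apply: bounded_sumsM => //; exists D.
Qed.

Definition sq1_to u (l : R) := sq1 (fun n => u n - l).

Lemma sq1_to_cvg u l : sq1_to u l -> u @ \oo --> l.
Proof.
move=> /sq1_cvg0 h; have -> : u = (fun n => (u n - l) + l).
  by apply/funext => n; rewrite subrK.
by rewrite -[X in _ --> X]add0r; apply: cvgD => //; exact: cvg_cst.
Qed.

Lemma sq1_to_eq u v l : sq1_to v l -> (\forall n \near \oo, u n = v n) -> sq1_to u l.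
Proof. by move=> sv uv; apply: (sq1_eq sv); apply: filterS uv => n ->. Qed.

Lemma sq1_toS u l : sq1_to (fun n => u n.+1) l <-> sq1_to u l.
Proof. exact: (sq1S (fun n => u n - l)). Qed.

Lemma sq1_to_cst l : sq1_to (fun=> l) l.
Proof.
exists 0 => N; rewrite big1// => n _; by rewrite subrr expr0n mulr0.
Qed.

Lemma sq1_toD u v l m : sq1_to u l -> sq1_to v m ->
  sq1_to (fun n => u n + v n) (l + m).
Proof.
move=> su sv; apply: (sq1_eq (sq1D su sv)); apply: nearW => n; ring.
Qed.

Lemma sq1_toB u v l m : sq1_to u l -> sq1_to v m ->
  sq1_to (fun n => u n - v n) (l - m).
Proof.
move=> su sv; apply: (sq1_eq (sq1B su sv)); apply: nearW => n; ring.
Qed.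

Lemma cvg_norm_le u (l : R) : u @ \oo --> l ->
  \forall n \near \oo, `|u n| <= `|l| + 1.
Proof.
move/cvgrPdist_le => /(_ 1 ltr01); apply: filterS => n h.
by have := ler_normB l (l - u n); rewrite subKr; lra.
Qed.

Lemma sq1_toM u v l m : sq1_to u l -> sq1_to v m ->
  sq1_to (fun n => u n * v n) (l * m).
Proof.
move=> su sv; have ub := cvg_norm_le (sq1_to_cvg su).
apply: (sq1_eq (sq1D (sq1M ub sv) (sq1Z m su))); apply: nearW => n; ring.
Qed.

Lemma sq1_toV u l : l != 0 -> sq1_to u l -> sq1_to (fun n => (u n)^-1) l^-1.
Proof.
move=> l0 su; have uv : (fun n => (u n)^-1) @ \oo --> l^-1.
  exact: cvgV l0 (sq1_to_cvg su).
rewrite /sq1_to; apply: (sq1_eq (sq1M (cvg_norm_le uv) (sq1Z (- l^-1) su))).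
have := sq1_to_cvg su => /cvgrPdist_lt /(_ `|l|); rewrite normr_gt0 => /(_ l0).
apply: filterS => n /= h.
have un : u n != 0 by apply: contraTneq h => ->; rewrite subr0 ltxx.
by field; rewrite un l0.
Qed.

End WeightedSquareSummable.

(** * The double commutation *)

Section TailSums.
Variable R : realType.
Implicit Types (beta : R^nat).

Lemma tail_sumS beta n : cond_summable beta ->
  tail_sum beta n.+1 - tail_sum beta n = beta n.+1.
Proof.
move=> cb; rewrite /tail_sum opprK addrC.
have cv m : cvgn (fun N => \sum_(m.+1 <= k < N) beta k).
  have -> : (fun N => \sum_(m.+1 <= k < N) beta k) = (fun N => 
     \sum_(1 <= k < N) beta k - \sum_(1 <= k < minn m.+1 N) beta k).
    apply/funext => N; have [h|h] := leqP m.+1 N.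
      by rewrite (@big_cat_nat _ _ _ m.+1 1 N)//= addrC addrK.
    by rewrite subrr big_geq// ltnW.
  apply: is_cvgB => //; apply/cvg_ex; exists (\sum_(1 <= k < m.+1) beta k).
  apply: cvg_near_cst; exists m.+1 => // N /= h.
  by have -> : minn m.+1 N = m.+1 by lia.
rewrite -limB//; apply/cvg_lim => //; apply: cvg_near_cst.
exists n.+2 => // N /= h; rewrite -[LHS]/(_ - _) [X in X - _]big_ltn; last by lia.
by rewrite addrK.
Qed.

Lemma tail_sum_cvg0 beta : cond_summable beta -> tail_sum beta @ \oo --> 0.
Proof.
move=> cb.
have E n : tail_sum beta n = \sum_(1 <= k < n.+1) beta k + tail_sum beta 0%N.
  elim: n => [|n IH]; first by rewrite big_geq// add0r.
  rewrite big_nat_recr//= -(tail_sumS n cb) IH; ring.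
have -> : tail_sum beta = (fun n => \sum_(1 <= k < n.+1) beta k + tail_sum beta 0%N).
  exact/funext.
rewrite -[X in _ --> X](addNr (tail_sum beta 0%N)); apply: cvgD; last exact: cvg_cst.
have h : (fun N => \sum_(1 <= k < N) beta k) @ \oo --> - tail_sum beta 0%N.
  by rewrite /tail_sum opprK.
by rewrite -cvg_shiftS in h.
Qed.

Lemma cond_summable_cvg0 beta : cond_summable beta -> beta @ \oo --> 0.
Proof.
move=> cb; rewrite -(cvg_shiftS beta).
have -> : (fun n => beta n.+1) = (fun n => tail_sum beta n.+1 - tail_sum beta n).
  by apply/funext => n; rewrite tail_sumS.
suff : (fun n => tail_sum beta n.+1 - tail_sum beta n) @ \oo --> 0 - 0 by rewrite subrr.
apply: cvgB; last exact: tail_sum_cvg0.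
by have := tail_sum_cvg0 cb; rewrite -cvg_shiftS.
Qed.

Lemma sq1_tail_sum beta : cond_summable beta -> sq1 (tail_sum beta) -> sq1 beta.
Proof.
move=> cb sb; apply: (iffLR (sq1S beta)).
have -> : (fun n => beta n.+1) = (fun n => tail_sum beta n.+1 - tail_sum beta n).
  by apply/funext => n; rewrite tail_sumS.
by apply: sq1B => //; exact: (iffRL (sq1S (tail_sum beta))).
Qed.

End TailSums.

(** * Constants and algebraic identities of the double commutation *)

Section DoubleCommutation.
Variable R : realType.
Variables (a b : R^nat) (E : R) (phi : R^nat).
Hypothesis a_gt0 : forall n : nat, (1 <= n)%N -> 0 < a n.
Hypothesis phi0 : phi 0%N = 0.
Hypothesis phi1 : phi 1%N = 1.
Hypothesis phi_eq : forall n : nat, (1 <= n)%N -> jacobi a b phi n = E * phi n.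

Lemma solution_uniq u : u 0%N = 0 ->
  (forall n : nat, (1 <= n)%N -> jacobi a b u n = E * u n) ->
  forall n, u n = u 1%N * phi n.
Proof.
move=> u0 ue n.
suff : u n = u 1%N * phi n /\ u n.+1 = u 1%N * phi n.+1 by case.
elim: n => [|n [IH1 IH2]]; first by rewrite u0 phi0 phi1 mulr0 mulr1.
split=> //.
have := @ue n.+1 isT; have := @phi_eq n.+1 isT; rewrite /= IH1 IH2 => h1 h2.
have an : a n.+1 != 0 by rewrite lt0r_neq0 ?a_gt0.
by apply: (mulfI an); move/(congr1 (fun t => u 1%N * t)): h1 => h1; lra.
Qed.

(** A square-summable eigenvector [u] is a multiple of [phi], and the factor [u 1] is nonzero
    because [u] is. *)
Lemma eigenvector_l2 : Defs.eigenvalue a b E -> l2 phi.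
Proof.
move=> [u [[[u0 lu] _] [m um] ue]]; split=> //.
have H := solution_uniq u0 (fun n _ => ue n).
have u1 : u 1%N != 0 by apply: contra um => /eqP u1; rewrite H u1 mul0r.
have -> : (fun n => phi n ^+ 2) = (fun n => (u 1%N)^-2 *: (u n ^+ 2)).
  apply/funext => n; rewrite /GRing.scale/= (H n) exprMn mulrA mulVf ?mul1r//.
  by rewrite sqrf_eq0.
exact: is_cvg_seriesZ.
Qed.

(** Two consecutive zeros would propagate down the recursion to [phi 1 = 1], as the [a n] do not
    vanish. *)
Lemma phi_consecutive n : phi n.+1 = 0 -> phi n.+2 <> 0.
Proof.
elim: n => [|n IH] h1 h2; first by move: h1; rewrite phi1 => /eqP; rewrite oner_eq0.
have := @phi_eq n.+2 isT; rewrite /= h1 h2 !mulr0 !addr0 => /eqP.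
rewrite mulf_eq0 (gt_eqF (@a_gt0 n.+1 isT)) /= => /eqP h.
exact: IH.
Qed.

Hypothesis phi_l2 : l2 phi.
Let g := dc_gamma phi.
Let c := dc_c phi.

Let S := inner phi phi.

(** The inequality is strict because one of the next two entries is nonzero; this keeps every [c n]
    positive although [c] tends to 0. *)
Let partial_lt n : \sum_(1 <= j < n.+1) phi j ^+ 2 < S.
Proof.
have cS : series (fun n => phi n * phi n) @ \oo --> S by case: phi_l2.
have mono : nondecreasing_seq (series (fun n => phi n * phi n)).
  by apply/nondecreasing_seqP => m; rewrite /series/= big_nat_recr//= lerDl -expr2 sqr_ge0.
have le m : series (fun n => phi n * phi n) m <= S.
  by apply: nondecreasing_cvgn_le => //; case: phi_l2.
apply: (@lt_le_trans _ _ (series (fun n => phi n * phi n) n.+3)) => //.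
rewrite /series/= [X in _ < X]big_ltn// phi0 mulr0 add0r.
rewrite (@big_nat_recr _ _ _ n.+2 1)//= (@big_nat_recr _ _ _ n.+1 1)//= -addrA.
under [X in _ < X + _]eq_bigr do rewrite -expr2.
rewrite ltrDl -!expr2 lt_def addr_ge0 ?sqr_ge0// andbT.
rewrite paddr_eq0 ?sqr_ge0// !sqrf_eq0; apply/negP => /andP[/eqP h1 /eqP h2].
exact: phi_consecutive h1 h2.
Qed.

Lemma dc_gamma_lt0 : g < 0.
Proof.
rewrite /g /dc_gamma oppr_lt0 invr_gt0.
by have := partial_lt 0; rewrite big_geq.
Qed.

Lemma dc_c0 : c 0%N = 1.
Proof. by rewrite /c /dc_c big_geq// mulr0 addr0. Qed.

Lemma dc_cS n : c n.+1 = c n + g * phi n.+1 ^+ 2.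
Proof. by rewrite /c /dc_c big_nat_recr//= mulrDr addrA. Qed.

Lemma dc_c_gt0 n : 0 < c n.
Proof.
rewrite /c /dc_c /dc_gamma mulNr subr_gt0 mulrC ltr_pdivrMr ?mul1r; last first.
  by have := partial_lt 0; rewrite big_geq.
exact: partial_lt.
Qed.

(** [gamma] is the value for which the limit [1 + gamma * S] vanishes. *)
Lemma dc_c_cvg0 : c @ \oo --> 0.
Proof.
have Sn0 : S != 0 by rewrite gt_eqF//; have := partial_lt 0; rewrite big_geq.
have -> : 0 = 1 + g * S by rewrite /g /dc_gamma mulNr mulVf// subrr.
apply: cvgD; first exact: cvg_cst.
apply: cvgMr.
have cS : series (fun n => phi n * phi n) @ \oo --> S by case: phi_l2.
rewrite -cvg_shiftS in cS; apply: cvg_trans cS; apply: near_eq_cvg.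
apply: nearW => n; rewrite /series/= big_ltn// phi0 mulr0 add0r.
by apply: eq_bigr => i _; rewrite expr2.
Qed.

Lemma dc_a_sqr n : (1 <= n)%N ->
  dc_a a phi n ^+ 2 = a n ^+ 2 * (c n.-1 * c n.+1 / c n ^+ 2).
Proof.
move=> n1; rewrite /dc_a exprMn expr_div_n sqr_sqrtr// mulr_ge0// ltW//; exact: dc_c_gt0.
Qed.

Definition dc_F : R^nat := fun n => g * (a n * phi n * phi n.+1) / c n.

(** The counterpart of [dc_F] for the squares of the two matrices: its increments are the
    differences of their diagonal entries. *)
Definition dc_H : R^nat := fun n =>
  2 * E * dc_F n - g * a n ^+ 2 * (phi n ^+ 2 + phi n.+1 ^+ 2) / c n.

Lemma dc_bE n : (1 <= n)%N -> dc_b a b phi n = b n + (dc_F n - dc_F n.-1).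
Proof. by case: n => // n _; rewrite /dc_b /dc_F /= -/g -/c; ring. Qed.

(* The left-hand side is the difference of the (n+1)-st diagonal entries of the
   squares of the two matrices. *)
Lemma dc_trace2 n (x := fun k => dc_a a phi k ^+ 2 - a k ^+ 2)
    (d := dc_F n.+1 - dc_F n) : (1 <= n)%N ->
  x n.+1 + x n + d * (2 * b n.+1 + d) = dc_H n.+1 - dc_H n.
Proof.
move=> n1; rewrite /x !dc_a_sqr//=.
(* The equation of [phi] eliminates [b n.+1]; what remains is an identity of rational functions. *)
have bd : d * b n.+1 = g * (a n.+1 * phi n.+2 / c n.+1 - a n * phi n / c n)
      * (E * phi n.+1 - a n * phi n - a n.+1 * phi n.+2).
  by have := @phi_eq n.+1 isT; rewrite /= => <-; rewrite /d /dc_F; ring.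
have -> : d * (2 * b n.+1 + d) = 2 * (d * b n.+1) + d * d by ring.
rewrite bd /d /dc_H /dc_F.
have e0 : c n.-1 = c n - g * phi n ^+ 2.
  by rewrite -[in c n](prednK n1) -[in phi n](prednK n1) dc_cS; ring.
rewrite e0 dc_cS.
have := dc_c_gt0 n; have := dc_c_gt0 n.+1.
rewrite dc_cS; set C := c n => h1 h2.
by field; rewrite !gt_eqF.
Qed.

End DoubleCommutation.

(** * Asymptotics of the two solutions *)

(** For [E > 2], [rho] is the smaller root of [x^2 - E x + 1], the product of the roots being 1;
    negative [E] follows by symmetry. *)
Lemma joukowski_preimage (R : realType) (E : R) : ~~ (-2 <= E <= 2) ->
  exists rho, [/\ rho != 0, `|rho| < 1 & E = rho + rho^-1].
Proof.
wlog E0 : E / 0 <= E.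
  move=> wl h; have [E0|E0] := leP 0 E; first exact: wl.
  have [||r [r0 r1 e]] := wl (- E); [by lra|by apply: contra h; lra|].
  exists (- r); split; rewrite ?oppr_eq0 ?normrN//.
  by rewrite invrN; lra.
move=> h; have E2 : 2 < E by rewrite ltNge; apply: contra h; lra.
have D0 : 0 <= E ^+ 2 - 4 by nra.
pose D := Num.sqrt (E ^+ 2 - 4).
have D2 : D ^+ 2 = E ^+ 2 - 4 by rewrite sqr_sqrtr.
have Dp : 0 <= D by exact: sqrtr_ge0.
have DE : D < E by nra.
have DE2 : E - 2 < D by nra.
have r0 : 0 < (E - D) / 2 by lra.
exists ((E - D) / 2); split; first exact: lt0r_neq0.
  by rewrite gtr0_norm//; lra.
rewrite [X in _ + X](_ : _ = (E + D) / 2); first by field.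
apply: (mulfI (lt0r_neq0 r0)); rewrite divff ?lt0r_neq0//.
have -> : (E - D) / 2 * ((E + D) / 2) = (E ^+ 2 - D ^+ 2) / 4 by field.
by rewrite D2; field.
Qed.

(** Keeps the denominator of the Riccati recursion away from 0: the two margins add up to exactly
    [|E| - 1]. *)
Lemma normB2_ge1 (R : realType) (E x y : R) :
  `|x| < (`|E| - 2) / 2 -> `|y| <= 1 + (`|E| - 2) / 2 -> 1 <= `|E - x - y|.
Proof.
move=> hx hy; have := ler_normD (E - x - y) y.
by have := ler_normD (E - x) x; rewrite !subrK; lra.
Qed.

Section Asymptotics.
Variable R : realType.
Variables (a b : R^nat) (E : R) (phi : R^nat).
Hypothesis a_gt0 : forall n : nat, (1 <= n)%N -> 0 < a n.
Hypothesis phi0 : phi 0%N = 0.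
Hypothesis phi1 : phi 1%N = 1.
Hypothesis phi_eq : forall n : nat, (1 <= n)%N -> jacobi a b phi n = E * phi n.
Hypothesis phi_l2 : l2 phi.
Hypothesis a_cvg : (fun n => a n ^+ 2) @ \oo --> (1 : R).
Hypothesis b_cvg : b @ \oo --> (0 : R).
Variable rho : R.
Hypothesis rho_neq0 : rho != 0.
Hypothesis rho_lt1 : `|rho| < 1.
Hypothesis E_rho : E = rho + rho^-1.

Let c := dc_c phi.
Let g := dc_gamma phi.
Let a2 := fun n => a n ^+ 2.
Let at2 := fun n => dc_a a phi n ^+ 2.
Let bt := dc_b a b phi.

Lemma normE_gt2 : 2 < `|E|.
Proof.
have r0 : 0 < `|rho| by rewrite normr_gt0.
have : `|E| = `|rho| + `|rho|^-1.
  have [h|h] := ltrP 0 rho.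
    by rewrite E_rho !gtr0_norm ?addr_gt0 ?invr_gt0.
  have h' : rho < 0 by rewrite lt_neqAle rho_neq0.
  have h2 : rho^-1 < 0 by rewrite invr_lt0.
  rewrite E_rho ltr0_norm; last by lra.
  by rewrite (ltr0_norm h') invrN opprD.
move=> ->; rewrite -subr_gt0.
have -> : `|rho| + `|rho|^-1 - 2 = (1 - `|rho|) ^+ 2 / `|rho|.
  by field; rewrite gt_eqF.
by rewrite divr_gt0// exprn_gt0// subr_gt0.
Qed.

Lemma a_le (eps : R) : 0 < eps -> \forall n \near \oo, a n <= 1 + eps.
Proof.
move=> e0; move/cvgrPdist_lt: a_cvg => /(_ _ e0) h; near=> n.
have n1 : (1 <= n)%N by near: n; exists 1%N.
have : `|1 - a n ^+ 2| < eps by near: n; exact: h.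
rewrite ltr_norml => /andP[h1 _]; have := a_gt0 n1; nra.
Unshelve. all: by end_near. Qed.

(** If [|phi|] failed to decrease at a late site, the recursion, with [|E| > 2] and nearly free
    coefficients, would keep it from ever decreasing again, although [phi] tends to 0. *)
Lemma eigenvector_decr : \forall n \near \oo,
  phi n != 0 /\ `|phi n.+1| < `|phi n|.
Proof.
(* With [|E| = 2 + 3 eps], the two known terms of the recursion take [1 + 2 eps], and the [1 + eps]
   that is left matches the bound on the last coefficient. *)
have E2 := normE_gt2; pose eps := (`|E| - 2) / 3.
have e0 : 0 < eps by rewrite /eps; lra.
have bN : \forall n \near \oo, `|b n| < eps.
  by move/cvgrPdist_lt: b_cvg => /(_ _ e0); apply: filterS => n; rewrite sub0r normrN.
have [N _ H] := filterI (a_le e0) bN.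
have step n : (N < n)%N -> `|phi n| <= `|phi n.+1| -> `|phi n.+1| <= `|phi n.+2|.
  move=> Nn h.
  have [h1 _] := H n (ltnW Nn); have [h2 h3] := H n.+1 (leqW (ltnW Nn)).
  have n1 : (1 <= n)%N by exact: leq_trans Nn.
  have := @phi_eq n.+1 isT; rewrite /= => e.
  have p1 : 0 < a n by exact: a_gt0.
  have p2 : 0 < a n.+1 by exact: a_gt0.
  have : `|E| * `|phi n.+1| <= a n * `|phi n| + `|b n.+1| * `|phi n.+1| + a n.+1 * `|phi n.+2|.
    rewrite -normrM -e (le_trans (ler_normD _ _))// !normrM (gtr0_norm p2) lerD2r.
    by rewrite (le_trans (ler_normD _ _))// !normrM (gtr0_norm p1).
  have q1 : a n * `|phi n| <= (1 + eps) * `|phi n.+1|.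
    by apply: ler_pM => //; exact: ltW.
  have q2 : `|b n.+1| * `|phi n.+1| <= eps * `|phi n.+1|.
    by rewrite ler_wpM2r// ltW.
  have q3 : a n.+1 * `|phi n.+2| <= (1 + eps) * `|phi n.+2|.
    by rewrite ler_wpM2r.
  have -> : `|E| = 3 * eps + 2 by rewrite /eps; field.
  move=> q4; rewrite -(@ler_pM2l _ (1 + eps)); last by lra.
  lra.
exists N.+1 => // n /= Nn.
have key : `|phi n.+1| < `|phi n|.
  rewrite ltNge; apply/negP => h.
  have grow j : `|phi (n + j)%N| <= `|phi (n + j).+1| /\ `|phi n.+1| <= `|phi (n + j).+1|.
    elim: j => [|j [h1 h2]]; first by rewrite addn0.
    have h3 : `|phi (n + j).+1| <= `|phi (n + j).+2|.
      by apply: step => //; exact: leq_trans Nn (leq_addr _ _).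
    by rewrite !addnS; split => //; exact: (le_trans h2).
  (* A zero here would force [phi n = 0] as well, and two consecutive zeros are impossible. *)
  have pn : 0 < `|phi n.+1|.
    rewrite normr_gt0; apply/eqP => z; move: h; rewrite z normr0 normr_le0 => /eqP z'.
    have nn : n.-1.+1 = n by rewrite prednK// (leq_trans _ Nn).
    apply: (@phi_consecutive _ a b E phi a_gt0 phi1 phi_eq n.-1); rewrite nn //.
  move/cvgrPdist_lt: (l2_cvg0 phi_l2) => /(_ _ pn) [M _ HM].
  have := HM (n + M).+1 (leqW (leq_addl n M)); rewrite sub0r normrN ltNge.
  by rewrite (grow M).2.
by split => //; rewrite -normr_gt0 (le_lt_trans _ key).
Qed.

(* dc_ratio n and tail_weight n belong to site n + 1. *)
Definition ratio : R^nat := fun n => a n * phi n.+1 / phi n.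
Definition tail_ratio : R^nat := fun n => c n.+1 / c n.
Definition tail_weight : R^nat := fun n => (1 - tail_ratio n)^-1.
Definition dc_ratio : R^nat := fun n => ratio n.+1 / tail_ratio n.
Let s := ratio.
Let Z := tail_ratio.
Let w := tail_weight.
Let st := dc_ratio.
Let w8 := (1 - rho ^+ 2)^-1.

Let rho2_lt1 : rho ^+ 2 < 1.
Proof. by rewrite -real_normK ?num_real// exprn_ilt1. Qed.

Let c_gt0 n : 0 < c n.
Proof. exact: (@dc_c_gt0 _ a b E). Qed.

Let g_lt0 : g < 0.
Proof. exact: (@dc_gamma_lt0 _ a b E). Qed.

Let cS n : c n.+1 = c n + g * phi n.+1 ^+ 2.
Proof. exact: dc_cS. Qed.

Let rho_k : 0 <= `|rho| < 1. Proof. by rewrite normr_ge0. Qed.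

Lemma ratio_riccati : \forall n \near \oo, s n * (E - b n.+1 - s n.+1) = a n ^+ 2.
Proof.
have [N _ H] := eigenvector_decr; exists N => // n /= Nn.
have [h1 _] := H n Nn; have [h2 _] := H n.+1 (leqW Nn).
have := @phi_eq n.+1 isT; rewrite /= => e.
have {e}-> : E = (a n * phi n + b n.+1 * phi n.+1 + a n.+1 * phi n.+2) / phi n.+1.
  by rewrite e mulfK.
by rewrite /s /ratio; field; rewrite h1 h2.
Qed.

Let e1 : R^nat := fun n => (a n ^+ 2 - 1) + rho * b n.+1.

(** [rho] is a fixed point of the free recursion [s (E - s) = 1]. The denominators are at least 1 in
    absolute value, since [|s|] is eventually at most slightly above 1. *)
Lemma ratio_contraction : (\forall n \near \oo, `|s n - rho| <= 2 + `|rho|) /\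
  (\forall n \near \oo, `|s n - rho| <= `|rho| * `|s n.+1 - rho| + `|e1 n|).
Proof.
have E2 := normE_gt2; pose eps := (`|E| - 2) / 2.
have e0 : 0 < eps by rewrite /eps; lra.
have sb (d : R) : 0 < d -> \forall n \near \oo, `|s n| <= 1 + d.
  move=> d0; near=> n.
  have an : a n <= 1 + d by near: n; exact: a_le.
  have n1 : (1 <= n)%N by near: n; exists 1%N.
  have [p0 pl] : phi n != 0 /\ `|phi n.+1| < `|phi n| by near: n; exact: eigenvector_decr.
  rewrite /s /ratio !normrM normfV (gtr0_norm (a_gt0 n1)) ler_pdivrMr ?normr_gt0//.
  by apply: ler_pM => //; apply: ltW => //; exact: a_gt0.
split.
  by apply: filterS (sb _ ltr01) => n h; have := ler_normB (s n) rho; lra.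
near=> n.
have b1 : `|b n.+1| < eps.
  near: n; move/cvgrPdist_lt: b_cvg => /(_ _ e0) [N _ H]; exists N => // n /= Nn.
  by have := H n.+1 (leqW Nn); rewrite sub0r normrN.
have s1 : `|s n.+1| <= 1 + eps.
  by near: n; have [N _ H] := sb _ e0; exists N => // n /= Nn; exact: (H _ (leqW Nn)).
have ric : s n * (E - b n.+1 - s n.+1) = a n ^+ 2 by near: n; exact: ratio_riccati.
have D1 : 1 <= `|E - b n.+1 - s n.+1|.
  exact: normB2_ge1.
(* The fixed point equation [rho (E - rho) = 1] is subtracted from the Riccati equation; [e1]
   collects the deviation of the coefficients. *)
have key : (s n - rho) * (E - b n.+1 - s n.+1) = rho * (s n.+1 - rho) + e1 n.
  by rewrite mulrBl ric /e1 E_rho; field.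
apply: (@le_trans _ _ `|(s n - rho) * (E - b n.+1 - s n.+1)|).
  by rewrite normrM ler_peMr.
by rewrite key -normrM ler_normD.
Unshelve. all: by end_near. Qed.

Let cvgS (u : R^nat) (l : R) : u @ \oo --> l -> (fun n => u n.+1) @ \oo --> l.
Proof. by move=> h; rewrite -cvg_shiftS in h. Qed.

Lemma ratio_cvg : s @ \oo --> rho.
Proof.
have [h1 h2] := ratio_contraction.
have e10 : e1 @ \oo --> 0.
  suff : e1 @ \oo --> (1 - 1) + rho * 0 by rewrite subrr mulr0 addr0.
  apply: cvgD; first by apply: cvgB => //; exact: cvg_cst.
  by apply: cvgMr; exact: cvgS.
have := backward_cvg0 (x := fun n => s n - rho) rho_k e10 h1 h2.
move=> h; suff : (fun n => (s n - rho) + rho) @ \oo --> 0 + rho.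
  by rewrite add0r; under eq_fun do rewrite subrK.
by apply: cvgD => //; exact: cvg_cst.
Qed.

Let r2 : R^nat := fun n => s n ^+ 2 / a n ^+ 2.

Lemma r2_cvg : r2 @ \oo --> rho ^+ 2.
Proof.
suff : r2 @ \oo --> rho ^+ 2 / 1 by rewrite divr1.
apply: cvgM; last by apply: cvgV => //; exact: oner_neq0.
by rewrite expr2; under eq_fun do rewrite expr2; apply: cvgM; exact: ratio_cvg.
Qed.

Lemma r2E : \forall n \near \oo, r2 n = phi n.+1 ^+ 2 / phi n ^+ 2.
Proof.
near=> n.
have n1 : (1 <= n)%N by near: n; exists 1%N.
have [p0 pl] : phi n != 0 /\ `|phi n.+1| < `|phi n| by near: n; exact: eigenvector_decr.
by rewrite /r2 /s /ratio; field; rewrite p0 gt_eqF ?a_gt0.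
Unshelve. all: by end_near. Qed.

(** Since [c n = - gamma \sum_(j > n) phi_j^2], the weight is the tail of the squared norm of [phi]
    beyond [n], in units of [phi_(n+1)^2]. *)
Lemma tail_weightE : \forall n \near \oo, w n = c n / (- g * phi n.+1 ^+ 2).
Proof.
have [N _ H] := eigenvector_decr; exists N => // n /= Nn.
have [h2 _] := H n.+1 (leqW Nn).
rewrite /w /tail_weight /Z /tail_ratio cS.
have cn := c_gt0 n; have gn := g_lt0.
rewrite [1 - _](_ : _ = (- g * phi n.+1 ^+ 2) / c n); last by field; rewrite gt_eqF.
by rewrite invf_div.
Qed.

(** Splitting off the first term of the tail gives an affine recursion, whereas the one for the
    ratios [c_(n+1) / c_n] is not linear. *)
Lemma tail_weight_backward : \forall n \near \oo, w n = 1 + r2 n.+1 * w n.+1.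
Proof.
near=> n.
have -> : w n = c n / (- g * phi n.+1 ^+ 2) by near: n; exact: tail_weightE.
have -> : w n.+1 = c n.+1 / (- g * phi n.+2 ^+ 2).
  by near: n; have [N _ H] := tail_weightE; exists N => // n /= Nn; exact: (H _ (leqW Nn)).
have -> : r2 n.+1 = phi n.+2 ^+ 2 / phi n.+1 ^+ 2.
  by near: n; have [N _ H] := r2E; exists N => // n /= Nn; exact: (H _ (leqW Nn)).
have [p1 p2] : phi n.+1 != 0 /\ phi n.+2 != 0.
  near: n; have [N _ H] := eigenvector_decr; exists N => // n /= Nn.
  by split; [have [] := H n.+1 (leqW Nn)|have [] := H n.+2 (leqW (leqW Nn))].
rewrite cS; have gn := g_lt0.
by field; rewrite p1 p2 lt_eqF.
Unshelve. all: by end_near. Qed.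

(** Halfway between [rho ^+ 2] and 1, so that a sequence tending to [rho ^+ 2] is eventually at most
    [k0 < 1]. *)
Let k0 := (1 + rho ^+ 2) / 2.
Let k01 : 0 <= k0 < 1.
Proof. by rewrite /k0; have := sqr_ge0 rho; have := rho2_lt1; lra. Qed.

Let near_k0 (u : R^nat) : u @ \oo --> rho ^+ 2 -> \forall n \near \oo, u n <= k0.
Proof.
move=> h; have := rho2_lt1 => r1.
have d0 : 0 < (1 - rho ^+ 2) / 2 by lra.
move/cvgrPdist_le: h => /(_ _ d0); apply: filterS => n.
by rewrite ler_norml /k0 => /andP[]; lra.
Qed.

(* c_n + gamma phi_{n+1}^2 / (1 - k) increases to 0, as phi^2 decays at least
   like k^n. *)
Lemma tail_weight_bounded : \forall n \near \oo, 0 <= w n <= (1 - k0)^-1.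
Proof.
pose D n := c n + g * phi n.+1 ^+ 2 / (1 - k0).
have kk := k01.
have g0 := g_lt0.
have Dc : D @ \oo --> 0.
  suff : D @ \oo --> 0 + g * 0 ^+ 2 / (1 - k0) by rewrite expr0n/= mulr0 mul0r addr0.
  apply: cvgD; first exact: (@dc_c_cvg0 _ a b E).
  apply: cvgMl; apply: cvgMr.
  have p := cvgS (l2_cvg0 phi_l2).
  by rewrite expr2; under eq_fun do rewrite expr2; apply: cvgM.
have [N _ H] := filterI (filterI (near_k0 r2_cvg) r2E)
  (filterI eigenvector_decr tail_weightE).
exists N => // n /= Nn.
have mono j : D n <= D (n + j)%N.
  elim: j => [|j IH]; first by rewrite addn0.
  apply: (le_trans IH); rewrite addnS; set m := (n + j)%N.
  have Nm : (N <= m.+1)%N by rewrite leqW// (leq_trans Nn)// leq_addr.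
  have [[+ e] [[h _] _]] := H m.+1 Nm.
  rewrite e ler_pdivrMr; last by rewrite exprn_even_gt0//= h.
  move=> h1; rewrite /D cS -subr_ge0.
  rewrite [X in 0 <= X](_ : _ = (- g / (1 - k0)) * (k0 * phi m.+1 ^+ 2 - phi m.+2 ^+ 2)).
    by rewrite mulr_ge0// ?subr_ge0// divr_ge0//; lra.
  by field; lra.
have Dn : D n <= 0.
  have : cvgn D by apply/cvg_ex; exists 0.
  have := cvg_lim (@Rhausdorff R) Dc => <- cD.
  apply: limr_ge => //; exists n => // m /= nm.
  by rewrite -(subnKC nm).
have [_ [[h2 _] _]] := H n.+1 (leqW Nn).
have [_ [_ ->]] := H n Nn.
have q : 0 < - g * phi n.+1 ^+ 2.
  by rewrite mulr_gt0 ?oppr_gt0// exprn_even_gt0//= h2.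
apply/andP; split; first by rewrite divr_ge0// ltW.
by rewrite ler_pdivrMr//; move: Dn; rewrite /D; lra.
Qed.

(** [w8] is the sum of the geometric series in [rho ^+ 2], the fixed point of the limiting
    recursion. *)
Let w8E : w8 = 1 + rho ^+ 2 * w8.
Proof. by rewrite /w8; field; have := rho2_lt1; lra. Qed.

Let w8_gt0 : 0 < w8.
Proof. by rewrite /w8 invr_gt0; have := rho2_lt1; lra. Qed.

Let w_contraction : (\forall n \near \oo, `|w n - w8| <= (1 - k0)^-1 + w8) /\
  (\forall n \near \oo, `|w n - w8| <= k0 * `|w n.+1 - w8| + `|w8 * (r2 n.+1 - rho ^+ 2)|).
Proof.
split.
  apply: filterS tail_weight_bounded => n /andP[h1 h2].
  by have := ler_normB (w n) w8; rewrite (ger0_norm h1) (gtr0_norm w8_gt0); lra.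
near=> n.
have h : r2 n.+1 <= k0.
  by near: n; have [N _ H] := near_k0 r2_cvg; exists N => // n /= Nn; exact: (H _ (leqW Nn)).
have -> : w n = 1 + r2 n.+1 * w n.+1 by near: n; exact: tail_weight_backward.
have -> : 1 + r2 n.+1 * w n.+1 - w8 =
    r2 n.+1 * (w n.+1 - w8) + w8 * (r2 n.+1 - rho ^+ 2).
  by rewrite [in LHS]w8E; ring.
rewrite (le_trans (ler_normD _ _))// lerD2r normrM ler_wpM2r//.
by rewrite ger0_norm// divr_ge0// sqr_ge0.
Unshelve. all: by end_near. Qed.

Lemma tail_weight_cvg : w @ \oo --> w8.
Proof.
have [h1 h2] := w_contraction.
have ew : (fun n => w8 * (r2 n.+1 - rho ^+ 2)) @ \oo --> 0.
  suff : (fun n => w8 * (r2 n.+1 - rho ^+ 2)) @ \oo --> w8 * (rho ^+ 2 - rho ^+ 2).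
    by rewrite subrr mulr0.
  by apply: cvgMr; apply: cvgB; [exact: (cvgS r2_cvg)|exact: cvg_cst].
have h := backward_cvg0 (x := fun n => w n - w8) k01 ew h1 h2.
suff : (fun n => (w n - w8) + w8) @ \oo --> 0 + w8.
  by rewrite add0r; under eq_fun do rewrite subrK.
by apply: cvgD => //; exact: cvg_cst.
Qed.

Let ZE n : Z n = 1 - (w n)^-1.
Proof. by rewrite /w /tail_weight invrK opprB addrC subrK. Qed.

Let w8V : 1 - w8^-1 = rho ^+ 2.
Proof. by rewrite /w8 invrK; ring. Qed.

Let rho2_neq0 : rho ^+ 2 != 0. Proof. by rewrite sqrf_eq0. Qed.

Lemma tail_ratio_cvg : Z @ \oo --> rho ^+ 2.
Proof.
rewrite -w8V (_ : Z = fun n => 1 - (w n)^-1); last exact/funext.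
apply: cvgB; first exact: cvg_cst.
by apply: cvgV; [rewrite gt_eqF|exact: tail_weight_cvg].
Qed.

Let rhoV : rho / rho ^+ 2 = rho^-1.
Proof. by field. Qed.

Lemma dc_ratio_cvg : st @ \oo --> rho^-1.
Proof.
rewrite -rhoV; apply: cvgM; first exact: (cvgS ratio_cvg).
by apply: cvgV => //; exact: tail_ratio_cvg.
Qed.

Let Z_gt0 n : 0 < Z n.
Proof. by rewrite divr_gt0. Qed.

Let at2E n : at2 n.+1 = a2 n.+1 * (Z n.+1 / Z n).
Proof.
rewrite /at2 (@dc_a_sqr _ a b E)// -/c /a2 /Z /tail_ratio /=.
by field; rewrite !gt_eqF.
Qed.

(** Substituting [gamma phi_(n+1)^2 = c_(n+1) - c_n] turns [F_(n+1)] into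
    [s_(n+1) (1 - c_n / c_(n+1))]. *)
Let FE : \forall n \near \oo, dc_F a phi n.+1 = s n.+1 - st n.
Proof.
have [N _ H] := eigenvector_decr; exists N => // n /= Nn.
have [h2 _] := H n.+1 (leqW Nn).
rewrite /dc_F -/c -/g /st /dc_ratio /tail_ratio /s /ratio.
have cn := c_gt0 n; have cn1 := c_gt0 n.+1.
have -> : g = (c n.+1 - c n) / phi n.+1 ^+ 2 by rewrite cS; field.
by field; rewrite h2 !gt_eqF.
Qed.

Let HE : \forall n \near \oo, dc_H a E phi n.+1 =
  2 * E * dc_F a phi n.+1 - (a2 n.+1 + s n.+1 ^+ 2) * (1 - (Z n)^-1).
Proof.
have [N _ H] := eigenvector_decr; exists N => // n /= Nn.
have [h2 _] := H n.+1 (leqW Nn).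
rewrite /dc_H; congr (_ - _).
rewrite -/c -/g /tail_ratio /s /ratio /Z /tail_ratio /a2.
have cn := c_gt0 n; have cn1 := c_gt0 n.+1.
have -> : g = (c n.+1 - c n) / phi n.+1 ^+ 2 by rewrite cS; field.
by field; rewrite h2 !gt_eqF.
Qed.

Let near_S (P : nat -> Prop) : (\forall n \near \oo, P n) -> \forall n \near \oo, P n.+1.
Proof. by move=> [N _ H]; exists N => // n /= Nn; exact: (H _ (leqW Nn)). Qed.

(* st is the ratio of the growing solution phi_n / sqrt(c_{n-1} c_n) of the
   transformed equation. *)
Let dc_riccati : \forall n \near \oo,
  st n * (E - bt n.+2 - st n.+1) = at2 n.+1.
Proof.
near=> n.
have r1 : s n.+1 * (E - b n.+2 - s n.+2) = a n.+1 ^+ 2.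
  by near: n; exact: near_S ratio_riccati.
have F1 : dc_F a phi n.+1 = s n.+1 - st n by near: n; exact: FE.
have F2 : dc_F a phi n.+2 = s n.+2 - st n.+1 by near: n; exact: near_S FE.
have [p1 _] : phi n.+1 != 0 /\ `|phi n.+2| < `|phi n.+1|.
  by near: n; exact: near_S eigenvector_decr.
have [p2 _] : phi n.+2 != 0 /\ `|phi n.+3| < `|phi n.+2|.
  by near: n; exact: near_S (near_S eigenvector_decr).
have an : a n.+1 != 0 by rewrite gt_eqF// a_gt0.
have sn : s n.+1 != 0 by rewrite /s /ratio !mulf_neq0// invr_eq0.
have z0 : Z n != 0 by rewrite gt_eqF.
(* After this substitution everything is rational in the ratios at one site and the coefficients of
   the matrix. *)
have Z1 : Z n.+1 = 1 - s n.+1 ^+ 2 * (1 - Z n) / (a2 n.+1 * Z n).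
  rewrite /Z /tail_ratio !cS /s /ratio /a2.
  have c0 := c_gt0 n; have := c_gt0 n.+1; rewrite cS => c1.
  by field; rewrite p1 an !gt_eqF.
have -> : E = a n.+1 ^+ 2 / s n.+1 + b n.+2 + s n.+2 by rewrite -r1; field.
rewrite /bt dc_bE//= F1 F2 at2E Z1 /a2.
have -> : st n = s n.+1 / Z n by [].
by field; rewrite z0 sn an.
Unshelve. all: by end_near. Qed.

(** In terms of the transformed data the same weights satisfy a forward recursion, whose coefficient
    tends to [rho ^+ 2]. This allows [Z] to be controlled before anything more than convergence is
    known about [a] and [b]. *)
Let weight_forward : \forall n \near \oo,
  w n.+1 = 1 + (at2 n.+1 / st n ^+ 2) * w n.
Proof.
near=> n.
have e : w n = 1 + r2 n.+1 * w n.+1 by near: n; exact: tail_weight_backward.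
have [p1 _] : phi n.+1 != 0 /\ `|phi n.+2| < `|phi n.+1|.
  by near: n; exact: near_S eigenvector_decr.
have [p2 _] : phi n.+2 != 0 /\ `|phi n.+3| < `|phi n.+2|.
  by near: n; exact: near_S (near_S eigenvector_decr).
have -> : w n.+1 = c n.+1 / (- g * phi n.+2 ^+ 2).
  by near: n; exact: near_S tail_weightE.
have -> : w n = c n / (- g * phi n.+1 ^+ 2) by near: n; exact: tail_weightE.
have an : a n.+1 != 0 by rewrite gt_eqF// a_gt0.
rewrite at2E /st /dc_ratio /Z /tail_ratio /s /ratio /a2.
have c0 := c_gt0 n; have c1 := c_gt0 n.+1; have c2 := c_gt0 n.+2; have gn := g_lt0.
have E2 : c n.+2 = c n.+1 + g * phi n.+2 ^+ 2 by exact: cS.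
have gn0 : g != 0 by rewrite lt_eqF.
rewrite [in RHS]E2; move: gn0; generalize g => G gn0.
by field; rewrite p1 p2 an gn0 !gt_eqF.
Unshelve. all: by end_near. Qed.

Let near_st : \forall n \near \oo, 1 <= `|st n|.
Proof.
have r1 : 1 < `|rho^-1| by rewrite normfV invf_gt1// normr_gt0.
have d0 : 0 < `|rho^-1| - 1 by lra.
move/cvgrPdist_le: dc_ratio_cvg => /(_ _ d0); apply: filterS => n h.
by have := ler_normD (rho^-1 - st n) (st n); rewrite subrK; lra.
Qed.

(** * Smallness transferred from the original matrix *)

Section FromJ.
Hypothesis a_sq1 : sq1_to a2 1.
Hypothesis b_sq1 : sq1_to b 0.

Lemma ratio_sq1 : sq1_to s rho.
Proof.
have [_ h2] := ratio_contraction.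
apply: (sq1_backward rho_k _ _ h2).
  have := sq1_toD (sq1_toB a_sq1 (sq1_to_cst 1))
    (sq1_toM (sq1_to_cst rho) (iffRL (sq1_toS b 0) b_sq1)).
  by rewrite subrr mulr0 addr0 /sq1_to; under eq_fun do rewrite subr0.
suff : (fun n => s n - rho) @ \oo --> rho - rho by rewrite subrr.
by apply: cvgB; [exact: ratio_cvg|exact: cvg_cst].
Qed.

Lemma tail_ratio_sq1 : sq1_to Z (rho ^+ 2).
Proof.
have r2s : sq1_to r2 (rho ^+ 2).
  have := sq1_toM (sq1_toM ratio_sq1 ratio_sq1) (sq1_toV (oner_neq0 R) a_sq1).
  by rewrite invr1 mulr1.
have [_ h2] := w_contraction.
have ws : sq1_to w w8.
  apply: (sq1_backward k01 _ _ h2).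
    exact: sq1Z (iffRL (sq1_toS r2 _) r2s).
  suff : (fun n => w n - w8) @ \oo --> w8 - w8 by rewrite subrr.
  by apply: cvgB; [exact: tail_weight_cvg|exact: cvg_cst].
rewrite -w8V (_ : Z = fun n => 1 - (w n)^-1); last exact/funext.
apply: sq1_toB; first exact: sq1_to_cst.
by apply: sq1_toV => //; rewrite gt_eqF.
Qed.

Lemma dc_ratio_sq1 : sq1_to st rho^-1.
Proof.
rewrite -rhoV; apply: sq1_toM; first exact: (iffRL (sq1_toS s _) ratio_sq1).
by apply: sq1_toV => //; exact: tail_ratio_sq1.
Qed.

Lemma dc_F_sq1 : sq1_to (dc_F a phi) (rho - rho^-1).
Proof.
apply: (iffLR (sq1_toS _ _)); apply: sq1_to_eq FE.
by apply: sq1_toB; [exact: (iffRL (sq1_toS s _) ratio_sq1)|exact: dc_ratio_sq1].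
Qed.

Lemma dc_H_sq1 : exists l, sq1_to (dc_H a E phi) l.
Proof.
eexists; apply: (iffLR (sq1_toS _ _)); apply: sq1_to_eq HE.
apply: sq1_toB.
  by apply: sq1_toM; [exact: sq1_to_cst|exact: (iffRL (sq1_toS _ _) dc_F_sq1)].
apply: sq1_toM.
  apply: sq1_toD; first exact: (iffRL (sq1_toS a2 _) a_sq1).
  have := iffRL (sq1_toS s _) ratio_sq1 => h; exact: (sq1_toM h h).
apply: sq1_toB; first exact: sq1_to_cst.
by apply: sq1_toV rho2_neq0 tail_ratio_sq1.
Qed.

Lemma dc_a_sq1 : sq1_to at2 1.
Proof.
apply: (iffLR (sq1_toS _ _)).
rewrite (_ : (fun n => at2 n.+1) = (fun n => a2 n.+1 * (Z n.+1 / Z n))); last first.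
  by apply/funext => n; exact: at2E.
rewrite -[1]mulr1 -{2}(divff rho2_neq0).
apply: sq1_toM; first exact: (iffRL (sq1_toS a2 _) a_sq1).
apply: sq1_toM; first exact: (iffRL (sq1_toS Z _) tail_ratio_sq1).
by apply: sq1_toV rho2_neq0 tail_ratio_sq1.
Qed.

Hypothesis sum_b : cond_summable b.
Hypothesis sum_a : cond_summable (fun n => a n ^+ 2 - 1).
Hypothesis sum_bt : cond_summable (dc_b a b phi).
Hypothesis sum_at : cond_summable (fun n => dc_a a phi n ^+ 2 - 1).

(** The difference of the tail sums and [dc_F] have the same increments, so they differ by a
    constant. *)
Lemma tail_sum_dc_b :
  sq1 (fun n => tail_sum (dc_b a b phi) n - tail_sum b n).
Proof.
pose L n := tail_sum (dc_b a b phi) n - tail_sum b n.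
have LF n : L n = dc_F a phi n + L 0%N.
  elim: n => [|n IH].
    by rewrite [dc_F _ _ _](_ : _ = 0) ?add0r// /dc_F phi0 mulr0 mul0r mulr0 mul0r.
  have h1 := tail_sumS n sum_bt; have h2 := tail_sumS n sum_b.
  move: h1; rewrite dc_bE//= => h1; rewrite /L in IH *; lra.
have L0 : L @ \oo --> 0 - 0 by apply: cvgB; exact: tail_sum_cvg0.
have L1 : L @ \oo --> (rho - rho^-1) + L 0%N.
  have h : (fun n => dc_F a phi n + L 0%N) @ \oo --> (rho - rho^-1) + L 0%N.
    by apply: cvgD; [exact: sq1_to_cvg dc_F_sq1|exact: cvg_cst].
  by apply: cvg_trans h; apply: near_eq_cvg; apply: nearW => n; rewrite [RHS]LF.
(* Comparing the two limits identifies the constant as minus the limit of [dc_F]. *)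
have e : 0 - 0 = (rho - rho^-1) + L 0%N by exact: (cvg_unique (@Rhausdorff R) L0 L1).
apply: (sq1_eq dc_F_sq1); apply: nearW => n.
by rewrite -/(L n) LF; lra.
Qed.

(** Up to products [d * e] of small sequences, [x_n + x_(n+1)] is the increment of [H], and summing
    these counts the tail of [x] twice. *)
Lemma tail_sum_dc_a : sq1 (fun n => tail_sum (fun n => dc_a a phi n ^+ 2 - 1) n -
   tail_sum (fun n => a n ^+ 2 - 1) n).
Proof.
pose X n := tail_sum (fun n => dc_a a phi n ^+ 2 - 1) n -
   tail_sum (fun n => a n ^+ 2 - 1) n.
pose x n := at2 n - a2 n.
have XS n : X n.+1 - X n = x n.+1.
  have h1 := tail_sumS n sum_at; have h2 := tail_sumS n sum_a.
  by rewrite /X /x /at2 /a2; lra.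
have X0 : X @ \oo --> 0.
  suff : X @ \oo --> (0 : R) - 0 by rewrite subrr.
  by apply: cvgB; exact: tail_sum_cvg0.
have [H8 HH] := dc_H_sq1.
have xs : sq1_to x 0 by rewrite -(subrr 1); apply: sq1_toB dc_a_sq1 a_sq1.
pose d n := dc_F a phi n.+1 - dc_F a phi n.
have ds : sq1_to d 0.
  rewrite -(subrr (rho - rho^-1)); apply: sq1_toB; last exact: dc_F_sq1.
  exact: (iffRL (sq1_toS _ _) dc_F_sq1).
pose e n := 2 * b n.+1 + d n.
have es : sq1_to e 0.
  rewrite (_ : 0 = 2 * 0 + 0); last by rewrite mulr0 addr0.
  apply: sq1_toD => //; apply: sq1_toM; first exact: sq1_to_cst.
  exact: (iffRL (sq1_toS b _) b_sq1).
have zero (u : R^nat) : sq1_to u 0 -> sq1 u.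
  by move=> h; apply: (sq1_eq h); apply: nearW => n; rewrite subr0.
(* Chosen so that [t n - t n.+1 = d n * e n] and [t] tends to 0: the part [2 * X n - x n] is minus
   the sum of [x_k + x_(k+1)] over [k >= n]. *)
pose t n := (H8 - dc_H a E phi n) + 2 * X n - x n.
have ts : sq1 t.
  refine (@sq1_prod_tail _ t d e (zero _ ds) (zero _ es) _ _).
    suff : t @ \oo --> (H8 - H8) + 2 * 0 - (0 : R).
      by rewrite subrr mulr0 addr0 subr0.
    apply: cvgB; last exact: sq1_to_cvg xs.
    apply: cvgD; last by apply: cvgMr.
    by apply: cvgB; [exact: cvg_cst|exact: sq1_to_cvg HH].
  exists 1%N => // n /= n1; have := @dc_trace2 _ a b E phi a_gt0 phi0 phi1 phi_eq phi_l2 n n1.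
  rewrite -/at2 -/a2 /t => h; have h1 := XS n; rewrite /x /at2 /a2 in h1 *.
  move: h; rewrite -/(d n) -/(e n) => h; lra.
have Hs : sq1 (fun n => 2^-1 * ((dc_H a E phi n - H8) + x n + t n)).
  by apply: sq1Z; apply: sq1D => //; apply: sq1D => //; exact: zero.
by apply: (sq1_eq Hs); apply: nearW => n; rewrite -/(X n) /t; field.
Qed.

End FromJ.

(** * Smallness transferred back from the transformed matrix *)

Section FromTransformed.
Hypothesis at_sq1 : sq1_to at2 1.
Hypothesis bt_sq1 : sq1_to bt 0.

(** Solved for the next ratio, the Riccati equation runs forward and contracts to [1 / rho] with
    factor [|rho|], because [|st| >= 1]. *)
Let dc_ratio_sq1' : sq1_to st rho^-1.
Proof.
pose e n := `|at2 n.+1 - 1| + `|bt n.+2 - 0|.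
have es : sq1 e.
  have n1 (u : R^nat) : sq1 u -> sq1 (fun n => `|u n|).
    by move=> su; apply: (@sq1_dom _ 1 _ _ su); apply: nearW => n; rewrite normr_id mul1r.
  apply: sq1D; apply: n1; first exact: (iffRL (sq1_toS at2 _) at_sq1).
  exact: (iffRL (sq1_toS (fun n => bt n.+1) _) (iffRL (sq1_toS bt _) bt_sq1)).
apply: (sq1_forward rho_k es); near=> n.
have s1 : 1 <= `|st n| by near: n; exact: near_st.
have ric : st n * (E - bt n.+2 - st n.+1) = at2 n.+1 by near: n; exact: dc_riccati.
have s0 : st n != 0 by rewrite -normr_gt0; lra.
have -> : st n.+1 - rho^-1 =
    (rho * (st n - rho^-1) - (at2 n.+1 - 1)) / st n - (bt n.+2 - 0).
  by rewrite -ric E_rho; field; rewrite s0 rho_neq0.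
have -> : `|e n| = `|at2 n.+1 - 1| + `|bt n.+2 - 0| by rewrite ger0_norm// addr_ge0.
rewrite (le_trans (ler_normB _ _))// addrA lerD2r.
rewrite normrM normfV ler_pdivrMr ?normr_gt0//.
rewrite (le_trans (ler_normB _ _))// normrM ler_peMr// addr_ge0// mulr_ge0//.
Unshelve. all: by end_near. Qed.

(** With [st] under control, the coefficient of the forward recursion of the weights is close to
    [rho ^+ 2], and only transformed data enter it. *)
Let tail_ratio_sq1' : sq1_to Z (rho ^+ 2).
Proof.
pose q n := at2 n.+1 / st n ^+ 2.
have rV : rho^-1 * rho^-1 != 0 by rewrite mulf_neq0// invr_eq0.
have rE : 1 / (rho^-1 * rho^-1) = rho ^+ 2 by field.
have qs : sq1_to q (rho ^+ 2).
  rewrite -rE; apply: sq1_toM; first exact: (iffRL (sq1_toS at2 _) at_sq1).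
  apply: sq1_toV => //; exact: (sq1_toM dc_ratio_sq1' dc_ratio_sq1').
have ws : sq1_to w w8.
  apply: (sq1_forward k01 (sq1Z w8 qs)); near=> n.
  have h : q n <= k0 by near: n; exact: near_k0 (sq1_to_cvg qs).
  have -> : w n.+1 = 1 + q n * w n by near: n; exact: weight_forward.
  have -> : 1 + q n * w n - w8 = q n * (w n - w8) + w8 * (q n - rho ^+ 2).
    by rewrite [in LHS]w8E; ring.
  rewrite (le_trans (ler_normD _ _))// lerD2r normrM ler_wpM2r//.
  by rewrite ger0_norm// divr_ge0// sqr_ge0.
rewrite -w8V (_ : Z = fun n => 1 - (w n)^-1); last exact/funext.
apply: sq1_toB; first exact: sq1_to_cst.
by apply: sq1_toV => //; rewrite gt_eqF.
Unshelve. all: by end_near. Qed.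

Lemma sq1_of_dc_a : sq1_to a2 1.
Proof.
apply: (iffLR (sq1_toS _ _)).
rewrite (_ : (fun n => a2 n.+1) = (fun n => at2 n.+1 * (Z n / Z n.+1))); last first.
  by apply/funext => n; rewrite at2E; field; rewrite !gt_eqF.
rewrite -[1]mulr1 -{2}(divff rho2_neq0).
apply: sq1_toM; first exact: (iffRL (sq1_toS at2 _) at_sq1).
apply: sq1_toM; first exact: tail_ratio_sq1'.
apply: sq1_toV => //; exact: (iffRL (sq1_toS Z _) tail_ratio_sq1').
Qed.

Lemma sq1_of_dc_b : sq1_to b 0.
Proof.
have Fs : sq1_to (dc_F a phi) (rho - rho^-1).
  apply: (iffLR (sq1_toS _ _)); apply: sq1_to_eq FE.
  apply: sq1_toB; last exact: dc_ratio_sq1'.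
  rewrite (_ : (fun n => s n.+1) = (fun n => st n * Z n)); last first.
    by apply/funext => n; rewrite /st /dc_ratio divfK// gt_eqF// Z_gt0.
  rewrite [X in sq1_to _ X](_ : _ = rho^-1 * rho ^+ 2); last by field.
  by apply: sq1_toM; [exact: dc_ratio_sq1'|exact: tail_ratio_sq1'].
apply: (iffLR (sq1_toS _ _)).
rewrite (_ : (fun n => b n.+1) =
   (fun n => bt n.+1 - (dc_F a phi n.+1 - dc_F a phi n))); last first.
  by apply/funext => n; rewrite /bt dc_bE//=; ring.
rewrite (_ : 0 = 0 - ((rho - rho^-1) - (rho - rho^-1))); last by rewrite !subrr.
apply: sq1_toB; first exact: (iffRL (sq1_toS bt _) bt_sq1).
by apply: sq1_toB => //; exact: (iffRL (sq1_toS _ _) Fs).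
Qed.

End FromTransformed.

End Asymptotics.

(** * The equivalence for the tail sums *)

Section TailSumEquivalence.
Variables (R : realType) (a b : R^nat) (E : R) (phi : R^nat).
Hypothesis a_gt0 : forall n : nat, (1 <= n)%N -> 0 < a n.
Hypothesis E_out : ~~ (-2 <= E <= 2).
Hypothesis phi0 : phi 0%N = 0.
Hypothesis phi1 : phi 1%N = 1.
Hypothesis phi_eq : forall n : nat, (1 <= n)%N -> jacobi a b phi n = E * phi n.
Hypothesis phi_l2 : l2 phi.
Hypothesis sum_b : cond_summable b.
Hypothesis sum_a : cond_summable (fun n => a n ^+ 2 - 1).
Hypothesis sum_bt : cond_summable (dc_b a b phi).
Hypothesis sum_at : cond_summable (fun n => dc_a a phi n ^+ 2 - 1).

Lemma sqr_cvg1 (u : R^nat) : cond_summable (fun n => u n ^+ 2 - 1) ->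
  (fun n => u n ^+ 2) @ \oo --> (1 : R).
Proof.
move=> /cond_summable_cvg0 h.
suff : (fun n => (u n ^+ 2 - 1) + 1) @ \oo --> 0 + (1 : R).
  by rewrite add0r; under eq_fun do rewrite subrK.
by apply: cvgD => //; exact: cvg_cst.
Qed.

Let sq1_to0 (u : R^nat) : sq1 u -> sq1_to u 0.
Proof. by move=> h; apply: (sq1_eq h); apply: nearW => n; rewrite subr0. Qed.

Lemma dc_tail_sums :
  (l2_1 (tail_sum (dc_b a b phi)) /\
   l2_1 (tail_sum (fun n => dc_a a phi n ^+ 2 - 1)))
  <->
  (l2_1 (tail_sum b) /\ l2_1 (tail_sum (fun n => a n ^+ 2 - 1))).
Proof.
have [rho [r0 r1 rE]] := joukowski_preimage E_out.
have ac := sqr_cvg1 sum_a; have bc := cond_summable_cvg0 sum_b.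
(* Both directions rest on the comparison of tail sums under smallness of the parameters of [J].
   When only the transformed tail sums are known to be small, that smallness is first recovered by
   the forward recursions. *)
have key : sq1_to (fun n => a n ^+ 2) 1 -> sq1_to b 0 ->
  sq1 (fun n => tail_sum (dc_b a b phi) n - tail_sum b n) /\
  sq1 (fun n => tail_sum (fun n => dc_a a phi n ^+ 2 - 1) n -
   tail_sum (fun n => a n ^+ 2 - 1) n).
  by move=> sa sb; split; [exact: (tail_sum_dc_b a_gt0 phi0 phi1 phi_eq phi_l2 ac bc r0 r1 rE)
    |exact: (tail_sum_dc_a a_gt0 phi0 phi1 phi_eq phi_l2 ac bc r0 r1 rE)].
split=> -[/l2_1P tb /l2_1P ta].
  have sat := sq1_tail_sum sum_at ta.
  have sbt := sq1_to0 (sq1_tail_sum sum_bt tb).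
  have [|| h1 h2] := key.
  - exact: (sq1_of_dc_a a_gt0 phi0 phi1 phi_eq phi_l2 ac bc r0 r1 rE).
  - exact: (sq1_of_dc_b a_gt0 phi0 phi1 phi_eq phi_l2 ac bc r0 r1 rE).
  split; apply/l2_1P.
    by apply: (sq1_eq (sq1B tb h1)); apply: nearW => n; ring.
  by apply: (sq1_eq (sq1B ta h2)); apply: nearW => n; ring.
have [h1 h2] := key (sq1_tail_sum sum_a ta) (sq1_to0 (sq1_tail_sum sum_b tb)).
split; apply/l2_1P.
  by apply: (sq1_eq (sq1D tb h1)); apply: nearW => n; ring.
by apply: (sq1_eq (sq1D ta h2)); apply: nearW => n; ring.
Qed.

End TailSumEquivalence.

(** * Measures with a density *)

Section Density.
Context d (T : measurableType d) (R : realType).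
Variables (m1 m2 mu : {measure set T -> \bar R}).
Variable h : T -> R.
Hypothesis mh : measurable_fun setT h.
Hypothesis h0 : forall x, 0 <= h x.
Hypothesis m1E : forall A, measurable A ->
  m1 A = (m2 A + \int[mu]_(x in A) (h x)%:E)%E.
Import HBNNSimple.

Let mhE : measurable_fun [set: T] (fun x => (h x)%:E).
Proof. exact/measurable_EFinP. Qed.

Let density_nnsfun (g : {nnsfun T >-> R}) :
  (\int[m1]_x (g x)%:E = \int[m2]_x (g x)%:E + \int[mu]_x (g x * h x)%:E)%E.
Proof.
have mp y : measurable (g @^-1` [set y]) by exact: measurable_sfunP.
have -> : (\int[mu]_x (g x * h x)%:E =
    \sum_(y \in range g) (y%:E * \int[mu]_(x in g @^-1` [set y]) (h x)%:E))%E.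
  have ind0 y x : 0 <= y * \1_(g @^-1` [set y]) x.
    rewrite indicE; case: (boolP (x \in _)) => [|_]; last by rewrite mulr0.
    by rewrite inE /= => <-; rewrite mulr1.
  under eq_integral => x _.
    rewrite EFinM fimfunE -fsumEFin// ge0_mule_fsuml; last first.
      by move=> y; rewrite lee_fin.
    over.
  rewrite ge0_integral_fsum//=; first last.
  - by move=> y x _; rewrite mule_ge0// lee_fin.
  - move=> y; apply: emeasurable_funM => //; apply/measurable_EFinP.
    by apply: measurable_funM => //; exact: measurable_indic.
  apply: eq_fsbigr => y; rewrite inE => -[x0 _ yE].
  have y0 : 0 <= y by rewrite -yE.
  rewrite -ge0_integralZl//=; first last.
  - by move=> x _; rewrite lee_fin.
  - exact: measurable_funTS.
  rewrite [RHS]integral_mkcond; apply: eq_integral => x _.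
  rewrite patchE indicE; case: ifP => _; first by rewrite mulr1.
  by rewrite mulr0 mul0e.
rewrite !integralT_nnsfun !sintegralE -fsbig_split//=.
apply: eq_fsbigr => y; rewrite inE => -[x0 _ yE].
rewrite m1E// ge0_muleDr//; apply: integral_ge0 => x _; by rewrite lee_fin.
Qed.

(** The identity for simple functions extends by monotone convergence. The second measure [m2] is
    there because polarization writes a spectral measure as a sum of others plus a density. *)
Lemma integral_density (f : T -> R) : measurable_fun setT f ->
  (forall x, 0 <= f x) ->
  (\int[m1]_x (f x)%:E = \int[m2]_x (f x)%:E + \int[mu]_x (f x * h x)%:E)%E.
Proof.
move=> mf f0; have mfE : measurable_fun [set: T] (fun x => (f x)%:E) by exact/measurable_EFinP.
pose fn := nnsfun_approx measurableT mfE.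
have cf x : (fun n => fn n x) @ \oo --> f x.
  have := @cvg_nnsfun_approx _ _ _ _ measurableT _ mfE (fun x _ => f0 x) x I.
  by move/fine_cvgP => [_].
have nd x m n : (m <= n)%N -> fn m x <= fn n x.
  by move=> mn; have /lefP := @nd_nnsfun_approx _ _ _ _ measurableT _ mfE m n mn; exact.
have conv (m : {measure set T -> \bar R}) (k : T -> R) : measurable_fun setT k ->
    (forall x, 0 <= k x) ->
    (fun n => \int[m]_x (fn n x * k x)%:E)%E @ \oo --> (\int[m]_x (f x * k x)%:E)%E.
  move=> mk k0.
  have -> : (\int[m]_x (f x * k x)%:E =
      \int[m]_x (limn (fun n => (fn n x * k x)%:E)))%E.
    apply: eq_integral => x _; apply/esym/cvg_lim => //.
    by apply: cvg_EFin; [exact: nearW|apply: cvgMl; exact: cf].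
  apply: cvg_monotone_convergence => //.
  - by move=> n; apply/measurable_EFinP; exact: measurable_funM.
  - by move=> n x _; rewrite lee_fin mulr_ge0.
  - by move=> x _ m' n mn; rewrite lee_fin ler_wpM2r// nd.
have conv1 (m : {measure set T -> \bar R}) :
    (fun n => \int[m]_x (fn n x)%:E)%E @ \oo --> (\int[m]_x (f x)%:E)%E.
  have red (g : T -> R) : (\int[m]_x (g x)%:E = \int[m]_x (g x * cst 1 x)%:E)%E.
    by apply: eq_integral => x _; rewrite mulr1.
  rewrite red; under eq_fun do rewrite red.
  by apply: conv => // x; exact: ler01.
apply: (cvg_unique (@ereal_hausdorff R) (conv1 m1)).
rewrite (_ : (fun n => _) = fun n =>
  (\int[m2]_x (fn n x)%:E + \int[mu]_x (fn n x * h x)%:E)%E); last first.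
  by apply/funext => n; exact: density_nnsfun.
apply: cvgeD; [|exact: conv1|exact: conv].
by apply: ge0_adde_def; rewrite inE; apply: integral_ge0 => x _; rewrite lee_fin// mulr_ge0.
Qed.

End Density.

(** * Integrals against the restriction of a measure *)

Section RestrictedMeasure.
Context d (T : measurableType d) (R : realType).
Variables (m1 m2 : {measure set T -> \bar R}) (A : set T).
Hypothesis mA : measurable A.
Hypothesis m1E : forall B, measurable B -> m1 B = m2 (A `&` B).

Let m1C : m1 (~` A) = 0%E.
Proof. by rewrite m1E ?setICr ?measure0//; exact: measurableC. Qed.

Let onA (f : T -> \bar R) : (\int[m1]_(x in A) f x = \int[m2]_(x in A) f x)%E.
Proof. by apply: eq_measure_integral => B mB BA; rewrite m1E// setIidr. Qed.

Lemma ge0_integral_restricted (f : T -> \bar R) : measurable_fun setT f ->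
  (forall x, 0 <= f x)%E -> (\int[m1]_x f x = \int[m2]_(x in A) f x)%E.
Proof.
move=> mf f0; rewrite (@ge0_negligible_integral _ _ _ _ setT (~` A))//; last exact: measurableC.
by rewrite setTD setCK onA.
Qed.

Lemma integral_restricted (f : T -> \bar R) : m1.-integrable setT f ->
  (\int[m1]_x f x = \int[m2]_(x in A) f x)%E.
Proof.
move=> fi; rewrite (@negligible_integral _ _ _ _ setT (~` A))//; last exact: measurableC.
by rewrite setTD setCK onA.
Qed.

End RestrictedMeasure.

(** * Polynomials converging to a step function *)

Section Step.
Variable R : realType.
Implicit Types (x s q : R).

Lemma bernoulli_ineq x n : -1 <= x -> 1 + n%:R * x <= (1 + x) ^+ n.
Proof.
move=> x1; elim: n => [|n IH]; first by rewrite mul0r addr0 expr0.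
rewrite exprS -[n.+1]addn1 natrD.
have h : 0 <= 1 + x by lra.
have := ler_wpM2l h IH; have := ler0n R n; have := sqr_ge0 x; nra.
Qed.

Lemma cvg_nat_geometric q : 0 <= q < 1 -> (fun n => n%:R * q ^+ n) @ \oo --> 0.
Proof.
move=> /andP[q0 q1]; have [->|qn0] := eqVneq q 0.
  apply: cvg_near_cst; exists 1%N => // n /= n1.
  by rewrite expr0n; case: n n1 => // n _; rewrite mulr0.
have qp : 0 < q by rewrite lt_neqAle eq_sym qn0.
(* With [q = r ^+ 2], Bernoulli's inequality for [1 / r] bounds [n r^n] by a constant, and the other
   factor [r^n] tends to 0. *)
pose r := Num.sqrt q.
have rp : 0 < r by rewrite sqrtr_gt0.
have r2 : r ^+ 2 = q by rewrite sqr_sqrtr.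
have r1 : r < 1 by rewrite -sqrtr1 ltr_sqrt.
have z : (fun n => (r^-1 - 1)^-1 * r ^+ n) @ \oo --> 0.
  suff : (fun n => (r^-1 - 1)^-1 * r ^+ n) @ \oo --> (r^-1 - 1)^-1 * 0 by rewrite mulr0.
  by apply: cvgMr; apply: cvg_expr; rewrite gtr0_norm.
apply: (squeeze_cvgr _ (cvg_cst 0) z); apply: nearW => n.
have rn : 0 < r ^+ n by exact: exprn_gt0.
rewrite mulr_ge0 ?exprn_ge0//= -r2 -exprM mulnC exprM expr2 mulrA ler_pM2r//.
have rV : 0 < r^-1 - 1 by rewrite subr_gt0 invf_gt1.
rewrite -[X in _ <= X]mul1r ler_pdivlMr//.
have := bernoulli_ineq n (x := r^-1 - 1) ltac:(lra).
rewrite addrCA subrr addr0 exprVn => h.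
have h2 : n%:R * (r^-1 - 1) <= (r ^+ n)^-1 by lra.
by rewrite -mulrA [r ^+ n * _]mulrC mulrA -ler_pdivlMr// div1r.
Qed.

(* The steepening polynomials of Brosowski and Deutsch; the factor n in the
   exponent makes the value at 1/2 tend to 0. *)
Definition step n s : R := (1 - s ^+ n) ^+ (n * 2 ^ n).

Lemma step_itv n s : 0 <= s <= 1 -> 0 <= step n s <= 1.
Proof.
move=> /andP[s0 s1]; have h1 : 0 <= s ^+ n by exact: exprn_ge0.
have h2 : s ^+ n <= 1 by exact: exprn_ile1.
rewrite /step exprn_ge0 ?subr_ge0//= exprn_ile1 ?subr_ge0//; lra.
Qed.

(** Bernoulli's inequality gives the lower bound [1 - n (2 s)^n] and, since
    [(1 - s^n) (1 + s^n) <= 1], the upper bound [1 / (1 + n (2 s)^n)]. The latter is at most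
    [1 / (1 + n)] once [2 s >= 1], the point [1/2] included. *)
Lemma step_cvg s : 0 <= s <= 1 -> (fun n => step n s) @ \oo --> (if s < 2^-1 then 1 else 0 : R).
Proof.
move=> s01; have /andP[s0 s1] := s01.
have E n : (n * 2 ^ n)%:R * s ^+ n = n%:R * (2 * s) ^+ n :> R.
  by rewrite natrM natrX -mulrA -exprMn.
have [h|h] := ltP s 2^-1.
  have q01 : 0 <= 2 * s < 1 by lra.
  have z : (fun n => 1 - n%:R * (2 * s) ^+ n) @ \oo --> (1 : R).
    suff : (fun n => 1 - n%:R * (2 * s) ^+ n) @ \oo --> (1 : R) - 0 by rewrite subr0.
    by apply: cvgB; [exact: cvg_cst|exact: cvg_nat_geometric].
  have c1 : (fun _ : nat => 1 : R) @ \oo --> (1 : R) by exact: cvg_cst.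
  apply: (squeeze_cvgr _ z c1); apply: nearW => n.
  have /andP[_ ->] := step_itv n s01; rewrite andbT -E /step.
  have := bernoulli_ineq (n * 2 ^ n) (x := - s ^+ n).
  rewrite mulrN; apply; rewrite lerN2; exact: exprn_ile1.
have z : (fun n => (1 + n%:R)^-1) @ \oo --> (0 : R).
  apply: cvg_trans (@cvg_harmonic R); apply: near_eq_cvg; apply: nearW => n.
  by rewrite /harmonic /= -natr1 addrC.
have c0 : (fun _ : nat => 0 : R) @ \oo --> (0 : R) by exact: cvg_cst.
apply: (squeeze_cvgr _ c0 z); apply: nearW => n.
have /andP[-> _] := step_itv n s01 => /=.
have sn0 : 0 <= s ^+ n by exact: exprn_ge0.
have sn1 : s ^+ n <= 1 by exact: exprn_ile1.
have b := bernoulli_ineq (n * 2 ^ n) (x := s ^+ n) ltac:(lra).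
have np : 0 < 1 + n%:R :> R by rewrite ltr_pwDl.
have nb : 1 + n%:R <= (1 + s ^+ n) ^+ (n * 2 ^ n).
  apply: le_trans b; rewrite lerD2l E ler_peMr// exprn_ege1//; lra.
rewrite -[X in _ <= X]mul1r ler_pdivlMr//.
apply: (@le_trans _ _ (step n s * (1 + s ^+ n) ^+ (n * 2 ^ n))).
  by rewrite ler_wpM2l//; have /andP[] := step_itv n s01.
rewrite /step -exprMn; apply: exprn_ile1.
  by rewrite mulr_ge0//; lra.
have -> : (1 - s ^+ n) * (1 + s ^+ n) = 1 - (s ^+ n) ^+ 2 by ring.
by rewrite lerBlDr lerDl sqr_ge0.
Qed.

End Step.

(** * Measures determined by their moments *)

Section MomentProblem.
Variable R : realType.
Variables l r : R.
Implicit Types (m : borel_measure R).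

Let D : set (measurableTypeR R) := `[l, r]%classic.
(** This is [x - l] on [D]; clipping makes its powers nonnegative on the whole line, so that the
    moments make sense as extended reals. *)
Let t (x : measurableTypeR R) : R := Num.max (x - l) 0.
Let mD : measurable D. Proof. exact: measurable_itv. Qed.

Lemma measurable_clipped_power k : measurable_fun [set: measurableTypeR R]
  (fun x : measurableTypeR R => t x ^+ k).
Proof.
apply: measurable_funX; apply: measurable_maxr => //.
by apply: measurable_funB => //; exact: measurable_id.
Qed.

Let t0 x : 0 <= t x. Proof. by rewrite /t le_max lexx orbT. Qed.

Section OneMeasure.
Variable m : borel_measure R.
Hypothesis m_fin : (m setT < +oo)%E.
Hypothesis m_supp : m (~` D) = 0%E.

Let mDfin : (m D < +oo)%E.
Proof. by apply: le_lt_trans m_fin; apply: le_measure; rewrite ?inE. Qed.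

Let power_integrable k :
  m.-integrable D (EFin \o (fun x : measurableTypeR R => t x ^+ k)).
Proof.
apply: measurable_bounded_integrable => //.
  exact: measurable_funTS (measurable_clipped_power k).
exists ((r - l) ^+ k); split; first exact: num_real.
move=> M hM x; rewrite /D /= in_itv /= => /andP[x1 x2]; apply: le_trans (ltW hM).
rewrite ger0_norm ?exprn_ge0// lerXn2r ?nnegrE//; first by lra.
by rewrite /t ge_max; lra.
Qed.

Lemma integral_poly_moments (q : {poly R}) :
  (\int[m]_(x in D) (q.[t x])%:E =
   \sum_(i < size q) (q`_i)%:E * \int[m]_x (t x ^+ i)%:E)%E.
Proof.
under eq_integral do rewrite horner_coef -sumEFin.
rewrite integral_sum//; last first.
  move=> i; rewrite (_ : (fun x => _) = fun x => ((q`_i)%:E * (t x ^+ i)%:E)%E).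
    by apply: integrableZl => //; exact: power_integrable.
  by apply/funext => x; rewrite EFinM.
apply: eq_bigr => i _; under eq_integral do rewrite EFinM.
rewrite integralZl//; last exact: power_integrable.
congr (_ * _)%E; symmetry.
rewrite (@ge0_negligible_integral _ _ _ _ setT (~` D))//.
- by rewrite setTD setCK.
- exact: measurableC.
- by apply/measurable_EFinP; exact: measurable_clipped_power.
- by move=> x _; rewrite lee_fin exprn_ge0.
Qed.

End OneMeasure.

(** This is [step] after the affine map that sends [c] to [1/2] and, by the choice of [L], [D] into
    [[0, 1]], written as a polynomial in [x - l]. *)
Let step_poly (c : R) (n : nat) : {poly R} :=
  let L := `|c - l| + `|c - r| + 1 in
  (1 - ((2^-1 + (l - c) / (2 * L))%:P + (2 * L)^-1 *: 'X) ^+ n) ^+ (n * 2 ^ n).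

Let horner_step_poly c n x : D x ->
  (step_poly c n).[t x] = step n (2^-1 + (x - c) / (2 * (`|c - l| + `|c - r| + 1))).
Proof.
rewrite /D /= in_itv /= => /andP[x1 x2]; rewrite /step_poly /step.
rewrite horner_exp hornerD hornerN hornerC horner_exp hornerD hornerC hornerZ hornerX.
have -> : t x = x - l by rewrite /t max_l//; lra.
by congr ((1 - _ ^+ _) ^+ _); ring.
Qed.

Let cvg_step_poly (m : borel_measure R) (c : R) :
  (m setT < +oo)%E -> m (~` D) = 0%E ->
  (\int[m]_(x in D) ((step_poly c n).[t x])%:E)%E @[n --> \oo] --> m `]-oo, c[%classic.
Proof.
move=> m_fin m_supp.
have mDfin : (m D < +oo)%E by apply: le_lt_trans m_fin; apply: le_measure; rewrite ?inE.
pose L := `|c - l| + `|c - r| + 1; pose s x := 2^-1 + (x - c) / (2 * L).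
have L0 : 0 < 2 * L by rewrite /L; have := normr_ge0 (c - l); have := normr_ge0 (c - r); lra.
have s01 x : D x -> 0 <= s x <= 1.
  rewrite /D /= in_itv /= => /andP[x1 x2].
  have h1 : - L <= x - c.
    rewrite /L; have := ler_norm (c - l); have := normr_ge0 (c - r); lra.
  have h2 : x - c <= L.
    rewrite /L; have := ler_norm (- (c - r)); rewrite normrN; have := normr_ge0 (c - l); lra.
  have h3 : - 2^-1 <= (x - c) / (2 * L) by rewrite ler_pdivlMr//; lra.
  have h4 : (x - c) / (2 * L) <= 2^-1 by rewrite ler_pdivrMr//; lra.
  by rewrite /s; lra.
have sE x : (s x < 2^-1) = (x < c).
  by rewrite /s -[X in _ < X]addr0 ltrD2l pmulr_llt0 ?invr_gt0// subr_lt0.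
pose f (x : measurableTypeR R) : \bar R := (\1_(`]-oo, c[%classic) x)%:E.
have -> : m `]-oo, c[%classic = (\int[m]_(x in D) f x)%E.
  have z : m (`]-oo, c[%classic `\` D) = 0%E.
    apply: (subset_measure0 _ _ _ m_supp); [|exact: measurableC|exact: subIsetr].
    exact: measurableD.
  rewrite integral_indic//.
  have e := @measureDI _ _ _ m (`]-oo, c[%classic : set (measurableTypeR R)) D
    (measurable_itv _) mD.
  by rewrite [LHS]e [X in (X + _)%E](_ : _ = 0%E) ?add0e//; exact: z.
have [_ _] : [/\ m.-integrable D f,
    (\int[m]_(x in D) `|((step_poly c n).[t x])%:E - f x|)%E @[n --> \oo] --> 0%E &
    (\int[m]_(x in D) ((step_poly c n).[t x])%:E)%E @[n --> \oo] --> (\int[m]_(x in D) f x)%E].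
  apply: (@dominated_convergence _ _ _ m D mD
    (fun n x => ((step_poly c n).[t x])%:E) f (cst 1%E)).
  - move=> n; apply/measurable_EFinP.
    rewrite (_ : (fun x => _) = fun x => \sum_(i < size (step_poly c n))
      (step_poly c n)`_i * t x ^+ i); last by apply/funext => x; rewrite horner_coef.
    apply: measurable_funTS; apply: measurable_sum => i.
    by apply: measurable_funM => //; exact: measurable_clipped_power.
  - apply/measurable_EFinP; exact: measurable_indic.
  - apply: aeW => x Dx; apply: cvg_EFin; first exact: nearW.
    have h := step_cvg (s01 _ Dx); rewrite sE in h.
    rewrite (_ : \1__ x = if x < c then 1 else 0); last first.
      rewrite indicE; have -> : (x \in `]-oo, c[%classic) = (x < c).
        by apply/idP/idP; rewrite inE /= in_itv.
      by case: ifP.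
    apply: cvg_trans h; apply: near_eq_cvg; apply: nearW => n.
    by rewrite /= horner_step_poly.
  - by apply: (@measurable_bounded_integrable _ _ _ m (cst 1)) => //; exists 1; split;
      [exact: num_real|move=> B B1 x _; rewrite /cst normr1; exact: ltW].
  - apply: aeW => x n Dx; rewrite horner_step_poly//.
    have /andP[h1 h2] := step_itv n (s01 _ Dx).
    by rewrite /= lee_fin ger0_norm.
by [].
Qed.

(** The steepening polynomials recover the mass of every ray []-oo, c[] from the moments; the rays
    are stable under intersection and generate the Borel sets. *)
Lemma measure_eq_of_moments (m1 m2 : borel_measure R) :
  (m1 setT < +oo)%E -> m1 (~` D) = 0%E -> m2 (~` D) = 0%E ->
  (forall k, \int[m1]_x (t x ^+ k)%:E = \int[m2]_x (t x ^+ k)%:E)%E ->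
  forall A, measurable A -> m1 A = m2 A.
Proof.
move=> f1 s1 s2 mom.
have f2 : (m2 setT < +oo)%E.
  (* The moments of order 0 are the total masses, so [m2] is finite as well. *)
  have := mom 0%N; under eq_integral do rewrite expr0.
  under [X in _ = X -> _]eq_integral do rewrite expr0.
  by rewrite !integral_cst// !mul1e => <-.
apply: (@measure_unique _ R (measurableTypeR R) (@RGenInftyO.G R)
  (fun k : nat => `]-oo, k%:R[%classic)).
- exact: RGenInftyO.measurableE.
- move=> _ _ [x ->] [y ->]; exists (Num.min x y).
  by apply/seteqP; split => z /=; rewrite !in_itv/= lt_min => /andP.
- by move=> k; exists k%:R.
- apply/seteqP; split => // x _; exists (Num.Def.archi_bound `|x|) => //=.
  by rewrite in_itv /= (le_lt_trans (ler_norm x))// archi_boundP.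
- move=> _ [c ->].
  have c1 := cvg_step_poly (c := c) f1 s1; have c2 := cvg_step_poly (c := c) f2 s2.
  apply: (cvg_unique (@ereal_hausdorff R) c1).
  rewrite (_ : (fun n => _) = fun n => (\int[m2]_(x in D) ((step_poly c n).[t x])%:E)%E)//.
  apply/funext => n; rewrite !integral_poly_moments//; apply: eq_bigr => i _.
  by rewrite mom.
- move=> k; apply: le_lt_trans f1; apply: le_measure; rewrite ?inE//.
Qed.

End MomentProblem.

(** * Moments of a spectral resolution *)

Section SpectralMoments.
Variables (R : realType) (a b : R^nat) (M : R).
Hypothesis aM : forall n, (0 < n)%N -> `|a n| <= M.
Hypothesis bM : forall n, (0 < n)%N -> `|b n| <= M.
Variables (P : set (measurableTypeR R) -> R^nat -> R^nat) (mu : R^nat -> borel_measure R).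
Hypothesis sr : spectral_resolution a b P mu.
Variables (l r : R).
Hypothesis lM : l < - (3 * M).
Hypothesis rM : 3 * M < r.

Let J := jacobi a b.
Let K := shifted_jacobi a b (- l).
Let t (x : measurableTypeR R) : R := Num.max (x - l) 0.
Implicit Types (u w : R^nat) (A B : set (measurableTypeR R)).

Let l2K u : l2 u -> l2 (K u). Proof. exact: (l2_shifted aM bM). Qed.
Let l2P A u : measurable A -> l2 u -> l2 (P A u). Proof. exact: (sr_l2 sr). Qed.

Lemma spectral_total u : l2 u -> mu u setT = (inner u u)%:E.
Proof. by move=> lu; rewrite (sr_measure sr)// (sr_setT sr). Qed.

Let mu_fin u : l2 u -> (mu u setT < +oo)%E.
Proof. by move=> lu; rewrite spectral_total// ltry. Qed.

Lemma inner_projection A u : measurable A -> l2 u ->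
  inner (P A u) (P A u) = inner u (P A u).
Proof.
move=> mA lu; have lA := l2P mA lu.
by rewrite (sr_sym sr)// -(sr_setI sr)// setIid.
Qed.

(** [P A] is symmetric and multiplicative in [A], so projecting a vector restricts its spectral
    measure. Integrals over [A] thus become integrals over the line for another vector. *)
Lemma spectral_restr A u B : measurable A -> l2 u -> measurable B ->
  mu (P A u) B = mu u (A `&` B).
Proof.
move=> mA lu mB; have lA := l2P mA lu; have lB := l2P mB lA.
have mAB := measurableI _ _ mA mB.
rewrite !(sr_measure sr)// (sr_sym sr)//; congr ((inner _ _)%:E).
by rewrite -(sr_setI sr)// -(sr_setI sr)//  -setIA (setIC B) setIA setIid.
Qed.

Let mid : measurable_fun [set: measurableTypeR R] (fun x : measurableTypeR R => x%:E).
Proof. by apply/measurable_EFinP; exact: measurable_id. Qed.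

(** The domain of a bounded matrix is all of l^2, so the second moment is finite, and
    [|x| <= 1 + x ^+ 2]. *)
Let id_integrable u : l2 u ->
  (mu u).-integrable setT (fun x : measurableTypeR R => x%:E).
Proof.
move=> lu; have [h _] := sr_dom sr lu; have {h} fin := h (l2_jacobi_dom aM bM lu).
have i2 : (mu u).-integrable setT (fun x : measurableTypeR R => (x ^+ 2)%:E).
  apply/integrableP; split.
    by apply/measurable_EFinP; apply: measurable_funX; exact: measurable_id.
  by under eq_integral do rewrite gee0_abs ?lee_fin ?sqr_ge0//.
have i1 : (mu u).-integrable setT (EFin \o cst (1 : R)).
  apply: measurable_bounded_integrable => //; first exact: mu_fin.
  by exists 1; split; [exact: num_real|move=> B B1 x _; rewrite /cst normr1; exact: ltW].
apply: (le_integrable measurableT mid _ (integrableD measurableT i1 i2)) => x _.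
change (`|x|%:E <= `|1 + x ^+ 2|%:E)%E.
rewrite lee_fin [leRHS]ger0_norm; last by have := sqr_ge0 x; lra.
rewrite -(real_normK (num_real x)); have := sqr_ge0 (`|x| - 1); have := normr_ge0 x; nra.
Qed.

Let integral_id A u : measurable A -> l2 u ->
  (\int[mu u]_(x in A) x%:E)%E = (inner (P A u) (J (P A u)))%:E.
Proof.
move=> mA lu; have lA := l2P mA lu.
rewrite -(integral_restricted mA (fun B => spectral_restr mA lu (B := B)) (id_integrable lA)).
by rewrite (sr_form sr)//; exact: (l2_jacobi_dom aM bM).
Qed.

Let muE A u : measurable A -> l2 u -> mu u A = (inner (P A u) (P A u))%:E.
Proof. by move=> mA lu; rewrite inner_projection// (sr_measure sr). Qed.

Let integral_cst_fin A u (k : R) : measurable A -> l2 u ->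
  (\int[mu u]_(x in A) k%:E = (k * inner (P A u) (P A u))%:E)%E.
Proof. by move=> mA lu; rewrite integral_cst// muE// EFinM. Qed.

Let cst_integrable A u (k : R) : measurable A -> l2 u ->
  (mu u).-integrable A (fun=> k%:E).
Proof.
move=> mA lu; apply: (@measurable_bounded_integrable _ _ _ _ (cst k)) => //.
  by rewrite muE// ltry.
exists `|k|; split; first exact: num_real.
by move=> B B1 x _; rewrite /cst; exact: ltW.
Qed.

Let id_integrable_on A u : measurable A -> l2 u ->
  (mu u).-integrable A (fun x : measurableTypeR R => x%:E).
Proof. by move=> mA lu; apply: integrableS (id_integrable lu). Qed.

Let inner0 u : l2 u -> inner u u <= 0 -> inner u u = 0.
Proof. by move=> lu h; apply/le_anti; rewrite h inner_ge0. Qed.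

(** On vectors projected to [A] the form of [J] is at most [l] times the squared norm, yet at least
    [- (3 * M)] times it; as [l < - (3 * M)], the norm is 0. *)
Let mu_low u : l2 u -> mu u `]-oo, l[%classic = 0%E.
Proof.
move=> lu; set A := (X in mu u X); have mA : measurable A by exact: measurable_itv.
have lA := l2P mA lu; rewrite muE//; congr (_%:E); apply: inner0 => //.
have h : (\int[mu u]_(x in A) x%:E <= \int[mu u]_(x in A) l%:E)%E.
  apply: le_integral => //; [exact: id_integrable_on|exact: cst_integrable|].
  by move=> x; rewrite /A inE /= in_itv /= lee_fin => /ltW.
rewrite integral_id// integral_cst_fin// lee_fin in h.
have := jacobi_bounded aM bM lA; rewrite ler_norml => /andP[h1 _].
have e : 0 <= (l + 3 * M) * inner (P A u) (P A u) by rewrite /J in h; lra.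
have neg : l + 3 * M < 0 by rewrite -[3 * M]opprK subr_lt0.
by rewrite (nmulr_rge0 _ neg) in e.
Qed.

Let mu_high u : l2 u -> mu u `]r, +oo[%classic = 0%E.
Proof.
move=> lu; set A := (X in mu u X); have mA : measurable A by exact: measurable_itv.
have lA := l2P mA lu; rewrite muE//; congr (_%:E); apply: inner0 => //.
have h : (\int[mu u]_(x in A) r%:E <= \int[mu u]_(x in A) x%:E)%E.
  apply: le_integral => //; [exact: cst_integrable|exact: id_integrable_on|].
  by move=> x; rewrite /A inE /= in_itv /= andbT lee_fin => /ltW.
rewrite integral_id// integral_cst_fin// lee_fin in h.
have := jacobi_bounded aM bM lA; rewrite ler_norml => /andP[_ h1].
have e : 0 <= (3 * M - r) * inner (P A u) (P A u) by rewrite /J in h; lra.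
have neg : 3 * M - r < 0 by rewrite subr_lt0.
by rewrite (nmulr_rge0 _ neg) in e.
Qed.

Lemma spectral_support u : l2 u -> mu u (~` `[l, r]%classic) = 0%E.
Proof.
move=> lu; have -> : ~` `[l, r]%classic = `]-oo, l[%classic `|` `]r, +oo[%classic.
  by rewrite setCitv.
by rewrite measureU0 ?mu_low ?mu_high//; exact: measurable_itv.
Qed.

Let mt k : measurable_fun [set: measurableTypeR R] (fun x : measurableTypeR R => t x ^+ k).
Proof. exact: measurable_clipped_power. Qed.

Let t0 x : 0 <= t x. Proof. by rewrite /t le_max lexx orbT. Qed.

Let tE0 k x : (0 <= (t x ^+ k)%:E)%E. Proof. by rewrite lee_fin exprn_ge0. Qed.

Let integral_t u : l2 u -> (\int[mu u]_x (t x)%:E)%E = (inner u (K u))%:E.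
Proof.
move=> lu; have mlow : measurable (`]-oo, l[%classic : set (measurableTypeR R)).
  exact: measurable_itv.
have mt1 : measurable_fun [set: measurableTypeR R] (fun x : measurableTypeR R => (t x)%:E).
  by apply/measurable_EFinP; exact: (mt 1).
have ci := cst_integrable l measurableT lu.
rewrite (@ge0_negligible_integral _ _ _ _ setT _ _ mlow measurableT mt1
  (fun x _ => tE0 1 x) (mu_low lu)).
transitivity (\int[mu u]_(x in setT `\` `]-oo, l[%classic) (x%:E - l%:E))%E.
  apply: eq_integral => x; rewrite inE /= in_itv /= => -[_ /negP]; rewrite -leNgt => lx.
  by rewrite /t max_l ?subr_ge0.
rewrite -negligible_integral//; last 2 first.
- by apply: integrableB => //; exact: id_integrable.
- exact: mu_low.
rewrite integralB//; [|exact: id_integrable].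
rewrite integral_id// integral_cst_fin// (sr_setT sr)// -EFinB; congr (_%:E).
by rewrite (inner_shifted aM bM)// /J mulNr addrC.
Qed.

Let integral_restr A u (f : measurableTypeR R -> \bar R) : measurable A -> l2 u ->
  measurable_fun setT f -> (forall x, 0 <= f x)%E ->
  (\int[mu u]_(x in A) f x = \int[mu (P A u)]_x f x)%E.
Proof.
move=> mA lu mf f0; symmetry.
exact: (ge0_integral_restricted mA (fun B => spectral_restr mA lu (B := B)) mf f0).
Qed.

Let K_polar u w : l2 u -> l2 w ->
  inner (fun n => 1 * u n + w n) (K (fun n => 1 * u n + w n)) =
  inner u (K u) + 2 * inner u (K w) + inner w (K w).
Proof. exact: (shifted_polar aM bM). Qed.

Let inner_eq0 u : l2 u -> inner u u = 0 -> u = fun=> 0.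
Proof.
move=> lu u0; apply/funext => n; apply/eqP; rewrite -sqrf_eq0.
have := l2_partial_le n.+1 lu; rewrite u0 big_nat_recr//= => h.
rewrite eq_le sqr_ge0 andbT; apply: le_trans h; rewrite lerDr.
by apply: sumr_ge0 => i _; rewrite sqr_ge0.
Qed.

Let inner0l w : inner (fun=> 0) w = 0.
Proof.
by apply/cvg_lim => //; apply: cvg_near_cst; apply: nearW => N;
  rewrite /series/= big1// => i _; rewrite mul0r.
Qed.

Let l20 : l2 (fun=> 0 : R).
Proof. by apply: (@l2_of_bound _ _ 0) => // N; rewrite big1// => i _; rewrite expr0n. Qed.

(** The resolution determines the operator through quadratic forms only. Integrating [t] over [A]
    and its complement splits the form of [K], and polarization shows that [K] has no cross terms
    between the two ranges. *)
Lemma spectral_commute A u : measurable A -> l2 u -> P A (K u) = K (P A u).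
Proof.
move=> mA; have mC : measurable (~` A) by exact: measurableC.
have mt1 : measurable_fun [set: measurableTypeR R] (fun x : measurableTypeR R => (t x)%:E).
  by apply/measurable_EFinP; exact: (mt 1).
have te x : (0 <= (t x)%:E)%E by rewrite lee_fin.
have split u' : l2 u' -> inner (P A u') (K (P A u')) +
    inner (P (~` A) u') (K (P (~` A) u')) = inner u' (K u').
  move=> lu; apply: EFin_inj; rewrite EFinD -!integral_t//; try exact: l2P.
  rewrite -!integral_restr// -ge0_integral_setU//= ?setUCr//.
  by rewrite disj_set2E setICr.
have bil v w : l2 v -> l2 w -> inner (P A v) (K (P A w)) +
    inner (P (~` A) v) (K (P (~` A) w)) = inner v (K w).
  move=> lv lw; have h := split _ (l2_lin 1 lv lw).
  rewrite !(sr_linear sr)// !K_polar// in h; try exact: l2P.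
  by have := split _ lv; have := split _ lw; lra.
have PAC w : l2 w -> P (~` A) (P A w) = fun=> 0.
  move=> lw; have lAw := l2P mA lw; apply: inner_eq0; first exact: l2P.
  by apply: EFin_inj; rewrite -muE// spectral_restr// setICr measure0.
have PAA w : l2 w -> P A (P A w) = P A w by move=> lw; rewrite -(sr_setI sr)// setIid.
move=> lu; have lA := l2P mA lu; have lKu := l2K lu.
apply/funext => n.
have [->|n0] := posnP n; first by rewrite (l2P mA lKu).1 (l2K lA).1.
have ln := l2_delta R n0; have lAn := l2P mA ln.
rewrite -(inner_delta n (P A _)) -(inner_delta n (K _)) -(sr_sym sr)//.
(* Both sides are reduced to [inner (P A (delta R n)) (K (P A u))]: [e1] inserts a projection in
   front of [u], [e2] one in front of the unit vector. *)
have e1 := bil _ _ lAn lu; rewrite PAA// PAC// inner0l addr0 in e1.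
have e2 := bil _ _ ln lA; rewrite PAA// PAC// in e2.
have z : inner (P (~` A) (delta R n)) (K (fun=> 0)) = 0.
  by rewrite (shifted_sym aM bM (- l) (l2P mC ln) l20) inner_sym inner0l.
by rewrite -e2 z addr0 e1.
Qed.

Let l2_iter k u : l2 u -> l2 (iter k K u).
Proof. by move=> lu; elim: k => //= k; exact: l2K. Qed.

Let iter_commute k A u : measurable A -> l2 u -> P A (iter k K u) = iter k K (P A u).
Proof.
move=> mA lu; elim: k => //= k IH.
by rewrite spectral_commute// ?IH//; exact: l2_iter.
Qed.

(* With w = K^k u, polarization gives mu_{u+w} = mu_u + mu_w + 2 t^k mu_u;
   integrating t against both sides gives the next moment. *)
Lemma spectral_moment k u : l2 u ->
  (\int[mu u]_x (t x ^+ k)%:E)%E = (inner u (iter k K u))%:E.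
Proof.
elim: k u => [|k IH] u lu /=.
  by under eq_integral do rewrite expr0; rewrite integral_cst// mul1e spectral_total.
set w := iter k K u; have lw : l2 w by exact: l2_iter.
pose s := fun n => 1 * u n + w n; have ls : l2 s by exact: l2_lin.
have mh : measurable_fun [set: measurableTypeR R] (fun x : measurableTypeR R => 2 * t x ^+ k).
  by apply: measurable_funM => //; exact: mt.
have h0 x : 0 <= 2 * t x ^+ k by rewrite mulr_ge0// exprn_ge0.
have tkE n : measurable_fun [set: measurableTypeR R]
    (fun x : measurableTypeR R => (t x ^+ n)%:E).
  by apply/measurable_EFinP; exact: mt.
have dens A : measurable A -> mu s A =
    (measure_add (mu u) (mu w) A + \int[mu u]_(x in A) (2 * t x ^+ k)%:E)%E.
  move=> mA; have lAu := l2P mA lu; have lAw := l2P mA lw.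
  under eq_integral do rewrite EFinM.
  rewrite ge0_integralZl//; last by apply: measurable_funTS; exact: tkE.
  rewrite integral_restr// IH// -iter_commute// -/w.
  rewrite /measure_add /= /msum !big_ord_recl big_ord0 /= adde0.
  rewrite !(sr_measure sr)// -!EFinM -!EFinD; congr (_%:E).
  rewrite /s (sr_linear sr)// inner_lin//.
  rewrite !inner_linl// (inner_sym w (P A u)) !(sr_sym sr)//.
  by rewrite -(sr_setI sr)// setIid; ring.
have mt1 : measurable_fun [set: measurableTypeR R] t by exact: (mt 1).
have := integral_density mh h0 dens mt1 t0.
rewrite ge0_integral_measure_add//; first last.
- exact/measurable_EFinP.
- by move=> x _; rewrite lee_fin.
rewrite !integral_t// /s K_polar//.
have -> : (\int[mu u]_x (t x * (2 * t x ^+ k))%:E = 2%:E * \int[mu u]_x (t x ^+ k.+1)%:E)%E.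
  rewrite -ge0_integralZl//; apply: eq_integral => x _.
  by rewrite -EFinM exprS; congr (_%:E); ring.
(* The next moment is not yet known to be finite; an infinite value would contradict the finiteness
   of the other terms. *)
case: (\int[mu u]_x (t x ^+ k.+1)%:E)%E => [q| |].
- by rewrite -EFinM -!EFinD => -[] e; congr (_%:E); lra.
- by rewrite mulry gtr0_sg// mul1e.
- by rewrite mulrNy gtr0_sg// mul1e.
Qed.

End SpectralMoments.

(** * Moments of the transformed matrix *)

Section MomentRelation.
Variables (R : realType) (a b : R^nat) (E : R) (phi : R^nat).
Hypothesis a_gt0 : forall n : nat, (1 <= n)%N -> 0 < a n.
Hypothesis phi0 : phi 0%N = 0.
Hypothesis phi1 : phi 1%N = 1.
Hypothesis phi_eq : forall n : nat, (1 <= n)%N -> jacobi a b phi n = E * phi n.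
Hypothesis phi_l2 : l2 phi.
Implicit Types u : R^nat.

Let c := dc_c phi.
Let g := dc_gamma phi.
Let at' := dc_a a phi.
Let bt := dc_b a b phi.
Let r : R^nat := fun n => Num.sqrt (c n).

Let r_gt0 n : 0 < r n.
Proof. by rewrite sqrtr_gt0 (@dc_c_gt0 _ a b E). Qed.

Let r_neq0 n : r n != 0. Proof. by rewrite gt_eqF. Qed.

Let r2 n : r n ^+ 2 = c n.
Proof. by rewrite sqr_sqrtr// ltW// (@dc_c_gt0 _ a b E). Qed.

Let r0 : r 0%N = 1. Proof. by rewrite /r /c dc_c0 sqrtr1. Qed.

Let cS n : c n.+1 = c n + g * phi n.+1 ^+ 2. Proof. exact: dc_cS. Qed.

(* The transformed orthogonal polynomials are
   pt_n = al_n p_n + be_n \sum_(j <= n) phi_j p_j; the sequence be is the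
   growing solution of the transformed equation. *)
Let al : R^nat := fun n => r 1 * r n / r n.-1.
Let be : R^nat := fun n => - g * r 1 * phi n / (r n * r n.-1).

Let atE n : (1 <= n)%N -> at' n = a n * (r n.-1 * r n.+1 / r n ^+ 2).
Proof.
by move=> n1; rewrite /at' /dc_a -/c sqrtrM ?r2// ltW// (@dc_c_gt0 _ a b E).
Qed.

(** Valid also at [n = 0], where [phi 0 = 0] cancels the arbitrary entry [a 0]. *)
Let atbe n : at' n * be n = - g * r 1 * a n * phi n * r n.+1 / r n ^+ 3.
Proof.
case: n => [|n]; first by rewrite /be phi0 !(mulr0, mul0r).
by rewrite atE// /be /=; field; rewrite !r_neq0.
Qed.

(** After the factors [r] are cleared this is the equation of [phi], with corrections that cancel by
    [c_(n+1) - c_n = gamma phi_(n+1)^2]. *)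
Let be_eq n : at' n * be n + bt n.+1 * be n.+1 + at' n.+1 * be n.+2 = E * be n.+1.
Proof.
rewrite atbe atE// /bt dc_bE// /be /=.
have -> : E * (- g * r 1 * phi n.+1 / (r n.+1 * r n)) =
    - g * r 1 / (r n.+1 * r n) * (E * phi n.+1) by ring.
have -> : E * phi n.+1 = a n * phi n * (r n.+1 ^+ 2 / r n ^+ 2) +
   (b n.+1 + (dc_F a phi n.+1 - dc_F a phi n)) * phi n.+1 +
   a n.+1 * phi n.+2 * (r n ^+ 2 / r n.+1 ^+ 2).
  have := @phi_eq n.+1 isT; rewrite /= => <-; rewrite /dc_F -/c -/g !r2.
  have c0 : c n != 0 by rewrite -r2 expf_neq0.
  have c1 : c n.+1 != 0 by rewrite -r2 expf_neq0.
  rewrite cS in c1 *; by field; rewrite c0 c1.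
by field; rewrite !r_neq0.
Qed.

(** The transpose of the triangular matrix above: coefficients [u] in the transformed polynomials
    become coefficients in the original ones. [N] bounds the support of [u], so that the sum is
    finite. *)
Let V N u : R^nat := fun j => al j * u j + phi j * \sum_(j <= n < N) be n * u n.

Let green u m j : (j <= m)%N ->
  \sum_(j.+1 <= n < m.+1) be n * jacobi at' bt u n =
  E * (\sum_(j.+1 <= n < m.+1) be n * u n) +
  at' m * (be m * u m.+1 - be m.+1 * u m) - at' j * (be j * u j.+1 - be j.+1 * u j).
Proof.
elim: m => [|m IH] jm.
  have -> : j = 0%N by lia.
  by rewrite !big_geq// mulr0; ring.
move: jm; rewrite leq_eqVlt => /orP[/eqP ->|jm].
  by rewrite !big_geq// mulr0; ring.
rewrite big_nat_recr/=; last by lia.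
rewrite IH; last by lia.
rewrite [in RHS]big_nat_recr/=; last by lia.
have -> : E * (\sum_(j.+1 <= i < m.+1) be i * u i + be m.+1 * u m.+1) =
  E * (\sum_(j.+1 <= i < m.+1) be i * u i) + u m.+1 * (E * be m.+1) by ring.
by rewrite -be_eq; ring.
Qed.

Let suffix (F : R^nat) N n : (forall i, (N <= i)%N -> F i = 0) ->
  \sum_(n <= i < N) F i = F n + \sum_(n.+1 <= i < N) F i.
Proof.
move=> FN; have [h|h] := ltnP n N; first by rewrite big_ltn.
by rewrite FN// !big_geq// ?addr0// leqW.
Qed.

Variable C : R.
Let K := shifted_jacobi a b C.
Let Kt := shifted_jacobi at' bt C.

(** Summation by parts against [be] replaces [Kt u] by [(E + C) u] in the tails, up to local terms;
    on the other side the equation of [phi] produces the same factor. The index becomes [N.+1]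
    because [Kt] widens the support by one site. *)
Let intertwine u N : u 0%N = 0 -> (forall n, (N <= n)%N -> u n = 0) ->
  K (V N u) = V N.+1 (Kt u).
Proof.
move=> u0 uN; apply/funext => -[|n].
  by rewrite /K /Kt /V /shifted_jacobi /= u0 phi0; ring.
have uF i : (N <= i)%N -> be i * u i = 0 by move=> h; rewrite uN// mulr0.
have VK : V N.+1 (Kt u) n.+1 = al n.+1 * jacobi at' bt u n.+1 +
    phi n.+1 * (E * (\sum_(n.+1 <= i < N) be i * u i) -
       at' n * (be n * u n.+1 - be n.+1 * u n)) + C * V N u n.+1.
  rewrite /V /Kt /shifted_jacobi.
  have -> : \sum_(n.+1 <= i < N.+1) be i * (jacobi at' bt u i + C * u i) =
     \sum_(n.+1 <= i < N.+1) be i * jacobi at' bt u i +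
     C * \sum_(n.+1 <= i < N) be i * u i.
    under eq_bigr do rewrite mulrDr.
    rewrite big_split/=; congr (_ + _).
    under eq_bigr do rewrite mulrCA.
    rewrite -mulr_sumr; congr (_ * _).
    have [h|h] := leqP n.+1 N; last by rewrite !big_geq// ltnW.
    by rewrite big_nat_recr//= uF// addr0.
  have [h|h] := leqP n N.
    rewrite green//.
    have -> : \sum_(n.+1 <= i < N.+1) be i * u i = \sum_(n.+1 <= i < N) be i * u i.
      have [h'|h'] := leqP n.+1 N; last by rewrite !big_geq// ltnW.
      by rewrite big_nat_recr//= uF// addr0.
    by rewrite (uN N)// (uN N.+1)//; ring.
  have h2 : (N <= n)%N by exact: ltnW.
  rewrite !big_geq; try lia.
  by rewrite (uN n)// (uN n.+1); [ring|lia].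
rewrite VK /K /shifted_jacobi; congr (_ + _).
rewrite /jacobi /V (suffix n uF) (suffix n.+1 uF).
set T := \sum_(n.+2 <= i < N) be i * u i.
have e : E * (be n.+1 * u n.+1 + T) * phi n.+1 =
    (a n * phi n + b n.+1 * phi n.+1 + a n.+1 * phi n.+2) * (be n.+1 * u n.+1 + T).
  by have := @phi_eq n.+1 isT; rewrite /= => ->; ring.
have -> : phi n.+1 * (E * (be n.+1 * u n.+1 + T) - at' n * (be n * u n.+1 - be n.+1 * u n)) =
   E * (be n.+1 * u n.+1 + T) * phi n.+1 - phi n.+1 * (at' n * be n) * u n.+1
   + phi n.+1 * be n.+1 * (at' n * u n) by ring.
rewrite e atbe {e}.
(* [k1], [k3] and [k2] match the coefficients of [u n], [u n.+1] and [u n.+2]; the terms in the tail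
   [T] agree by the equation of [phi]. *)
have k1 : a n * (al n + phi n * be n) * u n = at' n * (al n.+1 + phi n.+1 * be n.+1) * u n.
  case: n {VK T} => [|n]; first by rewrite u0 !mulr0.
  rewrite atE// /al /be /=.
  have h1 : g * phi n.+1 ^+ 2 = r n.+1 ^+ 2 - r n ^+ 2 by rewrite !r2 cS; ring.
  have h2 : g * phi n.+2 ^+ 2 = r n.+2 ^+ 2 - r n.+1 ^+ 2 by rewrite !r2 cS; ring.
  have -> : r 1 * r n.+1 / r n + phi n.+1 * (- g * r 1 * phi n.+1 / (r n.+1 * r n)) =
     r 1 * r n.+1 / r n - r 1 * (g * phi n.+1 ^+ 2) / (r n.+1 * r n) by ring.
  have -> : r 1 * r n.+2 / r n.+1 + phi n.+2 * (- g * r 1 * phi n.+2 / (r n.+2 * r n.+1)) =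
     r 1 * r n.+2 / r n.+1 - r 1 * (g * phi n.+2 ^+ 2) / (r n.+2 * r n.+1) by ring.
  by rewrite h1 h2; field; rewrite !r_neq0.
have k2 : a n.+1 * al n.+2 = al n.+1 * at' n.+1.
  by rewrite atE// /al /=; field; rewrite !r_neq0.
have k3 : b n.+1 * al n.+1 - a n.+1 * phi n.+2 * be n.+1 =
    al n.+1 * bt n.+1 - phi n.+1 * (- g * r 1 * a n * phi n * r n.+1 / r n ^+ 3).
  rewrite /bt dc_bE//= /dc_F -/c -/g -!r2 /al /be /=.
  by field; rewrite !r_neq0.
have -> : a n * (al n * u n + phi n * (be n * u n + (be n.+1 * u n.+1 + T))) +
    b n.+1 * (al n.+1 * u n.+1 + phi n.+1 * (be n.+1 * u n.+1 + T)) +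
    a n.+1 * (al n.+2 * u n.+2 + phi n.+2 * T) =
  a n * (al n + phi n * be n) * u n +
  (b n.+1 * al n.+1 - a n.+1 * phi n.+2 * be n.+1) * u n.+1 +
  (a n.+1 * al n.+2) * u n.+2 +
  (a n * phi n + b n.+1 * phi n.+1 + a n.+1 * phi n.+2) * (be n.+1 * u n.+1 + T) by ring.
by rewrite k1 k2 k3; ring.
Qed.

Let e_ k := iter k Kt (delta R 1).

Let e0 k : e_ k 0%N = 0.
Proof. by elim: k => //= k IH; rewrite /Kt /shifted_jacobi /= -/(e_ k) IH mulr0 addr0. Qed.

Let e_supp k n : (k.+2 <= n)%N -> e_ k n = 0.
Proof.
elim: k n => [|k IH] [|n]// h; first by rewrite /e_ /= /delta; case: n h.
rewrite /e_ /= /Kt /shifted_jacobi /= -!/(e_ k) !IH ?mulr0 ?addr0//; lia.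
Qed.

(** The factor [r 1] in [al] and [be] is the normalization that makes this hold, since
    [r 1 ^+ 2 = 1 + gamma]. *)
Let V_delta : V 2 (delta R 1) = delta R 1.
Proof.
have r11 : r 1 ^+ 2 = 1 + g by rewrite r2 cS /c dc_c0 phi1; ring.
apply/funext => -[|[|j]].
- by rewrite /V phi0 /delta /= mulr0 mul0r addr0.
- rewrite /V big_nat1 /delta eqxx /al /be /= r0 phi1.
  have -> : - g = 1 - r 1 ^+ 2 by rewrite r11; ring.
  by field; rewrite r_neq0.
- by rewrite /V /delta /= big_geq// !mulr0 addr0.
Qed.

Let V_iter k : iter k K (delta R 1) = V k.+2 (e_ k).
Proof.
elim: k => [|k IH]; first by rewrite /e_ /= V_delta.
by rewrite iterS IH intertwine//; exact: e_supp.
Qed.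

(** As [be] solves the transformed equation at [E], each application of [Kt] multiplies the pairing
    by [E + C]; the boundary terms vanish by the finite support of [e_ k]. *)
Let be_iter k : \sum_(1 <= n < k.+2) be n * e_ k n = - g * (E + C) ^+ k.
Proof.
elim: k => [|k IH].
  by rewrite big_nat1 /e_ /= /delta eqxx /be /= r0 phi1; field; rewrite r_neq0.
rewrite /e_ iterS -/(e_ k) /Kt /shifted_jacobi.
under eq_bigr do rewrite mulrDr.
rewrite big_split/= green//.
under [X in _ + X]eq_bigr do rewrite mulrCA.
rewrite -mulr_sumr big_nat_recr//= (e_supp (n := k.+2))// (e_supp (n := k.+3))// e0 /be phi0.
by rewrite !(mulr0, mul0r, addr0, subr0) IH exprS; ring.
Qed.

(** The first entry of the intertwining relation: the diagonal part of [V] contributes the factor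
    [c_1], the tail part the moments of the point mass at [E]. *)
Lemma dc_moments k : iter k K (delta R 1) 1%N =
  dc_c phi 1 * iter k Kt (delta R 1) 1%N - dc_gamma phi * (E + C) ^+ k.
Proof.
rewrite V_iter /V be_iter phi1 mul1r /al /= r0 divr1 -expr2 r2 -/(e_ k) -/c -/g.
by rewrite mulNr.
Qed.

End MomentRelation.

(** * Spectral measures and their densities *)

Section SpectralMeasures.
Variable R : realType.

Lemma cvg_bound (u : R^nat) (l : R) : u @ \oo --> l ->
  exists M, forall n, `|u n| <= M.
Proof.
move=> ul; have cu : cvgn u by apply/cvg_ex; exists l.
have [M [_ HM]] := cvg_seq_bounded cu.
by exists (M + 1) => n; apply: HM => //; rewrite ltrDl.
Qed.

Lemma jacobi_bound (a b : R^nat) : cond_summable (fun n => a n ^+ 2 - 1) ->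
  cond_summable b -> exists M, (forall n, `|a n| <= M) /\ (forall n, `|b n| <= M).
Proof.
move=> /sqr_cvg1 /cvg_bound [M1 h1] /cond_summable_cvg0 /cvg_bound [M2 h2].
exists (1 + M1 + M2); split=> n; last first.
  by have := h1 0%N; have := normr_ge0 (a 0%N ^+ 2); have := h2 n; lra.
have := h1 n; rewrite normrX; have := h2 0%N; have := normr_ge0 (b 0%N).
have := sqr_ge0 (`|a n| - 1); have := normr_ge0 (a n); nra.
Qed.

Section DoubleCommutationMeasure.
Variables (a b : R^nat) (E : R) (phi : R^nat).
Hypothesis a_gt0 : forall n : nat, (1 <= n)%N -> 0 < a n.
Hypothesis phi0 : phi 0%N = 0.
Hypothesis phi1 : phi 1%N = 1.
Hypothesis phi_eq : forall n : nat, (1 <= n)%N -> jacobi a b phi n = E * phi n.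
Hypothesis phi_l2 : l2 phi.
Hypothesis sum_b : cond_summable b.
Hypothesis sum_a : cond_summable (fun n => a n ^+ 2 - 1).
Hypothesis sum_bt : cond_summable (dc_b a b phi).
Hypothesis sum_at : cond_summable (fun n => dc_a a phi n ^+ 2 - 1).
Variables nu nut : borel_measure R.
Hypothesis nuP : spectral_measure a b nu.
Hypothesis nutP : spectral_measure (dc_a a phi) (dc_b a b phi) nut.

Let c_gt0 : 0 < dc_c phi 1. Proof. exact: (dc_c_gt0 a_gt0 phi0 phi1 phi_eq phi_l2). Qed.
Let c_ge0 : 0 <= dc_c phi 1. Proof. exact: ltW. Qed.
Let g_ge0 : 0 <= - dc_gamma phi.
Proof. by rewrite oppr_ge0 ltW// (dc_gamma_lt0 a_gt0 phi0 phi1 phi_eq phi_l2). Qed.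

Lemma spectral_measure_fin : (nu setT < +oo)%E.
Proof.
case: nuP => P [mu [sr ->//]].
by rewrite (spectral_total sr) ?ltry//; exact: (@l2_delta R 1).
Qed.

Lemma dc_spectral_measure A : measurable A ->
  nu A = ((dc_c phi 1)%:E * nut A + (- dc_gamma phi)%:E * @dirac _ (measurableTypeR R) E R A)%E.
Proof.
have [M1 [h1 h2]] := jacobi_bound sum_a sum_b.
have [M2 [h3 h4]] := jacobi_bound sum_at sum_bt.
pose M := M1 + M2.
have M10 : 0 <= M1 by exact: le_trans (h1 0%N).
have M20 : 0 <= M2 by exact: le_trans (h3 0%N).
have aM n : (0 < n)%N -> `|a n| <= M by move=> _; have := h1 n; rewrite /M; lra.
have bM n : (0 < n)%N -> `|b n| <= M by move=> _; have := h2 n; rewrite /M; lra.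
have atM n : (0 < n)%N -> `|dc_a a phi n| <= M by move=> _; have := h3 n; rewrite /M; lra.
have btM n : (0 < n)%N -> `|dc_b a b phi n| <= M by move=> _; have := h4 n; rewrite /M; lra.
(* A single interval [[- r, r]] has to contain the supports of both spectral measures and the point
   [E]. *)
pose r := 3 * M + `|E| + 1.
have E0 := normr_ge0 E.
have rM : 3 * M < r by rewrite /r; lra.
have lM : - r < - (3 * M) by rewrite /r; lra.
have Er : - r <= E <= r.
  by rewrite -ler_norml /r /M; lra.
have [P [mu [sr nuE]]] := nuP; have [Pt [mut [srt nutE]]] := nutP.
have d1 : l2 (delta R 1) by exact: l2_delta.
pose m2 : borel_measure R := measure_add (mscale (NngNum c_ge0) nut)
  (mscale (NngNum g_ge0) (@dirac _ (measurableTypeR R) E R)).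
have m2E B : m2 B = ((dc_c phi 1)%:E * nut B +
    (- dc_gamma phi)%:E * @dirac _ (measurableTypeR R) E R B)%E.
  by rewrite /m2 /measure_add /= /msum !big_ord_recl big_ord0 /= adde0.
move=> mA; rewrite -m2E.
apply: (measure_eq_of_moments (l := - r) (r := r)) mA => //.
- exact: spectral_measure_fin.
- rewrite nuE; last by apply: measurableC; exact: measurable_itv.
  exact: (spectral_support aM bM sr lM rM).
- rewrite [LHS]m2E nutE; last by apply: measurableC; exact: measurable_itv.
  rewrite (spectral_support atM btM srt lM rM d1) mule0 add0e diracE memNset ?mule0//.
- move=> k.
  rewrite (eq_measure_integral (mu (delta R 1))); last by move=> B mB _; exact: nuE.
  rewrite (spectral_moment aM bM sr lM)// inner_delta.
  rewrite (dc_moments a_gt0 phi0 phi1 phi_eq phi_l2).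
  have mt := measurable_clipped_power (- r) k.
  have mtE : measurable_fun [set: measurableTypeR R]
      (fun x : measurableTypeR R => (Num.max (x - - r) 0 ^+ k)%:E).
    exact/measurable_EFinP.
  have t0 x : (0 <= (Num.max (x - - r) 0 ^+ k)%:E)%E.
    by rewrite lee_fin exprn_ge0// le_max lexx orbT.
  rewrite ge0_integral_measure_add// !ge0_integral_mscale//= integral_dirac//.
  rewrite diracE mem_set// mul1e.
  rewrite (eq_measure_integral (mut (delta R 1))); last by move=> B mB _; exact: nutE.
  rewrite (spectral_moment atM btM srt lM)// inner_delta.
  rewrite max_l; last by rewrite opprK; lra.
  by rewrite -!EFinM -EFinD; congr (_%:E); ring.
Qed.

End DoubleCommutationMeasure.

(** Off the null set that carries both singular parts and the atom, the relation between the
    measures reads [v = k * vt] under the integral sign, and integrals over all Borel sets determine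
    a density. *)
Lemma ac_density_dirac (nu nut : borel_measure R) (v vt : R -> R) (k g e : R) :
  0 <= k -> (nu setT < +oo)%E ->
  (forall A, measurable A ->
    nu A = (k%:E * nut A + g%:E * @dirac _ (measurableTypeR R) e R A)%E) ->
  ac_density nu v -> ac_density nut vt ->
  {ae lebesgue_measure, forall x : measurableTypeR R, v x = k * vt x}.
Proof.
move=> k0 nufin nuE [mv v0 [nus [[N1 [mN1 N10 nus0]] nuA]]].
move=> [mvt vt0 [nust [[N2 [mN2 N20 nust0]] nutA]]].
have mvE : measurable_fun [set: measurableTypeR R] (fun x : measurableTypeR R => (v x)%:E).
  exact/measurable_EFinP.
have mvtE : measurable_fun [set: measurableTypeR R] (fun x : measurableTypeR R => (vt x)%:E).
  exact/measurable_EFinP.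
pose N : set (measurableTypeR R) := N1 `|` (N2 `|` [set e]).
have me : measurable ([set e] : set (measurableTypeR R)) by exact: measurable_set1.
have mN : measurable N by apply: measurableU => //; apply: measurableU.
have N0 : lebesgue_measure N = 0%E.
  have h : lebesgue_measure (N2 `|` [set e]) = 0%E.
    by rewrite measureU0//; exact: lebesgue_measure_set1.
  by rewrite /N measureU0//; exact: measurableU.
have off (f : R -> R) A : measurable_fun [set: measurableTypeR R] f ->
    (forall x, 0 <= f x) -> measurable A ->
    (\int[lebesgue_measure]_(x in A) (f x)%:E =
     \int[lebesgue_measure]_(x in A `\` N) (f x)%:E)%E.
  move=> mf f0 mA; apply: ge0_negligible_integral => //.
  - by apply/measurable_EFinP; exact: measurable_funTS.
  - by move=> x _; rewrite lee_fin.
have sing (n : borel_measure R) N' A : measurable N' -> measurable A -> N' `<=` N ->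
    n (~` N') = 0%E -> n (A `\` N) = 0%E.
  move=> mN' mA NN n0; apply: (subset_measure0 _ _ _ n0).
  - exact: measurableD.
  - exact: measurableC.
  - by move=> x [_ xN] /NN.
have key A : measurable A -> (\int[lebesgue_measure]_(x in A) (v x)%:E =
    \int[lebesgue_measure]_(x in A) (k * vt x)%:E)%E.
  move=> mA; have mAN : measurable (A `\` N) by exact: measurableD.
  rewrite off// [RHS]off//; last 2 first.
  - by apply: measurable_funM.
  - by move=> x; rewrite mulr_ge0.
  have := nuE _ mAN; rewrite nuA// nutA//.
  rewrite (sing _ N1)//; last by move=> x; left.
  rewrite (sing nust N2)//; last by move=> x; right; left.
  rewrite !adde0 diracE memNset; last by move=> [_]; apply; right; right.
  rewrite mule0 adde0 => ->.
  under [RHS]eq_integral do rewrite EFinM.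
  rewrite ge0_integralZl//; first exact: measurable_funTS.
  by move=> x _; rewrite lee_fin.
(* The passage from equal integrals to equality almost everywhere uses the integrability of [v],
   which the finiteness of [nu] provides. *)
have iv : (lebesgue_measure : borel_measure R).-integrable setT
    (fun x : measurableTypeR R => (v x)%:E).
  apply/integrableP; split => //.
  under eq_integral do rewrite gee0_abs ?lee_fin//.
  apply: le_lt_trans nufin; rewrite nuA//; exact: leeDl.
have mk : measurable_fun [set: measurableTypeR R] (fun x : measurableTypeR R => (k * vt x)%:E).
  by apply/measurable_EFinP; exact: measurable_funM.
have := integral_ae_eq measurableT iv mk (fun A _ mA => key A mA).
by apply: filterS => x /(_ I) [].
Qed.

End SpectralMeasures.

(** * The class W *)

Section ClassW.
Variable R : realType.
Notation mu := (@lebesgue_measure R).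
Let I : set (measurableTypeR R) := `[- pi, pi]%classic.

Let mI : measurable I. Proof. exact: measurable_itv. Qed.

Let muI : (mu I < +oo)%E.
Proof. by rewrite /I lebesgue_measure_itv /=; case: ifP => _; rewrite ?ltry// -EFinB ltry. Qed.

Let pi_itv : (- pi : R) < pi.
Proof. by have := @pi_gt0 R; lra. Qed.

Let continuous_scale (F : R -> R) (w : R) : continuous F -> continuous (fun t => F (w * t)).
Proof.
move=> cF x; apply: (@continuous_comp _ _ _ (fun t => w * t) F); last exact: cF.
by apply: cvgMr; exact: cvg_id.
Qed.

Let integral_trig (F f : R -> R) (w : R) : w != 0 -> continuous f ->
  (forall x : R, is_derive x 1 F (f x)) -> F (w * pi) = F (w * - pi) ->
  \int[mu]_(t in I) f (w * t) = 0.
Proof.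
move=> w0 cf dF FE.
have dG (x : R) : is_derive x 1 (fun t => w^-1 * F (w * t)) (f (w * x)).
  have h : is_derive x 1 (F \o (fun t => w * t)) (f (w * x) * w).
    apply: is_derive1_comp.
    have h' : is_derive x 1 (w *: (@idfun R)) (w *: 1) by exact: is_deriveZ.
    by rewrite /GRing.scale /= mulr1 in h'.
  have h2 : is_derive x 1 (w^-1 *: (F \o (fun t => w * t))) (w^-1 *: (f (w * x) * w)).
    exact: is_deriveZ.
  have e : w^-1 *: (f (w * x) * w) = f (w * x).
    by rewrite /GRing.scale /= mulrC mulfK.
  by rewrite e in h2.
rewrite /Rintegral (@continuous_FTC2 _ (fun t => f (w * t)) (fun t => w^-1 * F (w * t)))//.
- by rewrite FE -EFinB subrr.
- by apply: continuous_subspaceT => x; apply: continuous_scale.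
- have cG : continuous (fun t => w^-1 * F (w * t)).
    by move=> x; apply: differentiable_continuous; apply/derivable1_diffP; apply: ex_derive.
  split.
  + by move=> x _; apply: ex_derive.
  + by apply: cvg_at_right_filter; exact: cG.
  + by apply: cvg_at_left_filter; exact: cG.
- by move=> x _; rewrite derive1E; apply: derive_val.
Qed.

Let sin_int_pi (n : int) : sin (n%:~R * pi) = 0 :> R.
Proof.
have nat_pi (m : nat) : sin (m%:R * pi) = 0 :> R.
  elim: m => [|m IH]; first by rewrite mul0r sin0.
  by rewrite -natr1 mulrDl mul1r sinDpi IH oppr0.
by case: n => m; rewrite ?NegzE ?rmorphN /= ?mulNr ?sinN nat_pi ?oppr0.
Qed.

Let cos_integral (n : int) : n != 0 -> \int[mu]_(t in I) cos (n%:~R * t) = 0.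
Proof.
move=> n0; apply: (integral_trig (F := sin)).
- by rewrite intr_eq0.
- exact: continuous_cos.
- by rewrite mulrN sinN sin_int_pi oppr0.
Qed.

Let sin_integral (n : int) : n != 0 -> \int[mu]_(t in I) sin (n%:~R * t) = 0.
Proof.
move=> n0; apply: (integral_trig (F := fun x => - cos x)).
- by rewrite intr_eq0.
- exact: continuous_sin.
- by move=> x; rewrite -[sin x]opprK; apply: is_deriveN.
- by rewrite mulrN cosN.
Qed.

Let fourier_add (T f : R -> R) (k : R) : continuous T ->
  (forall x, `|T x| <= 1) -> mu.-integrable I (EFin \o f) ->
  \int[mu]_(t in I) T t = 0 ->
  \int[mu]_(t in I) ((k + f t) * T t) = \int[mu]_(t in I) (f t * T t).
Proof.
move=> cT T1 fi T0.
have mT : measurable_fun I T.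
  by apply: measurable_funTS; exact: continuous_measurable_fun.
have bT : [bounded T x | x in I].
  exists 1; split; first exact: num_real.
  by move=> B B1 x _; apply: le_trans (T1 x) (ltW B1).
have Ti : mu.-integrable I (EFin \o T).
  apply: measurable_bounded_integrable => //.
under eq_Rintegral do rewrite mulrDl.
rewrite RintegralD//; last 2 first.
- exact: (integrableZl mI k Ti).
- exact: (integrableMl mI fi mT bT).
by rewrite RintegralZl// T0 mulr0 add0r.
Qed.

Lemma Hhalf_circle_add (f : R -> R) (k : R) :
  Hhalf_circle f -> Hhalf_circle (fun t => k + f t).
Proof.
move=> [fi fs]; split.
  have ki : mu.-integrable I (EFin \o cst k).
    apply: measurable_bounded_integrable => //.
    exists `|k|; split; first exact: num_real.
    by move=> B B1 x _; rewrite /cst; exact: ltW.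
  by apply: eq_integrable (integrableD mI ki fi).
rewrite (eq_esum (b := fun n : int => (`|n|%N%:R *
  (fourier_cos f n ^+ 2 + fourier_sin f n ^+ 2))%:E)) // => n _.
(* The coefficient at 0 may change, but its weight is 0; at the other frequencies the constant
   integrates to 0 against the trigonometric function. *)
have [->|n0] := eqVneq n 0; first by rewrite absz0 !mul0r.
congr ((_ * (_ ^+ 2 + _ ^+ 2))%:E); congr (_ * _).
  apply: (@fourier_add (fun t => cos (n%:~R * t))) => //.
  - by apply: continuous_scale; exact: continuous_cos.
  - by move=> x; rewrite ler_norml cos_geN1 cos_le1.
  - exact: cos_integral.
apply: (@fourier_add (fun t => sin (n%:~R * t))) => //.
- by apply: continuous_scale; exact: continuous_sin.
- by move=> x; rewrite ler_norml sin_geN1 sin_le1.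
- exact: sin_integral.
Qed.

(** The constant goes into [v0], with the same factor [w], and adds [ln k] to the logarithm. *)
Lemma class_W_scale (v vt : R -> R) (k : R) : 0 < k ->
  {ae mu, forall x : measurableTypeR R, v x = k * vt x} -> class_W vt -> class_W v.
Proof.
move=> k0 vE [v0 [w [v0p H wE ae]]].
exists (fun x => k * v0 x), w; split; [| |exact: wE|].
- by move=> x hx; rewrite mulr_gt0// v0p.
- have := Hhalf_circle_add (ln k) H; rewrite /Hhalf_interval; congr Hhalf_circle.
  apply/funext => t; rewrite lnM// posrE; apply: v0p.
  by have := cos_geN1 t; have := cos_le1 t; lra.
- apply: filterS2 vE ae => x -> ->; case: ifP => _; last by rewrite mulr0.
  by rewrite mulrCA.
Qed.

End ClassW.

Theorem proposition1p4 (R : realType) (a b : R^nat) (E : R) (phi : R^nat)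
  (a_gt0 : forall n : nat, (1 <= n)%N -> 0 < a n)
  (E_out : ~~ (-2 <= E <= 2))
  (E_isolated : isolated_eigenvalue a b E)
  (phi0 : phi 0%N = 0) (phi1 : phi 1%N = 1)
  (phi_eq : forall n : nat, (1 <= n)%N -> jacobi a b phi n = E * phi n)
  (sum_b : cond_summable b)
  (sum_a : cond_summable (fun n => a n ^+ 2 - 1))
  (sum_bt : cond_summable (dc_b a b phi))
  (sum_at : cond_summable (fun n => dc_a a phi n ^+ 2 - 1)) :
  ((l2_1 (tail_sum (dc_b a b phi)) /\
    l2_1 (tail_sum (fun n => dc_a a phi n ^+ 2 - 1)))
   <->
   (l2_1 (tail_sum b) /\ l2_1 (tail_sum (fun n => a n ^+ 2 - 1))))
  /\
  (forall (nu nut : borel_measure R) (v vt : R -> R),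
     spectral_measure a b nu ->
     spectral_measure (dc_a a phi) (dc_b a b phi) nut ->
     ac_density nu v -> ac_density nut vt ->
     (class_W vt <-> class_W v)).
Proof.
have phi_l2 : l2 phi by exact: (eigenvector_l2 a_gt0 phi0 phi1 phi_eq E_isolated.1).
split; first exact: dc_tail_sums a_gt0 E_out phi0 phi1 phi_eq phi_l2 sum_b sum_a sum_bt sum_at.
move=> nu nut v vt nuP nutP vP vtP.
have c0 := dc_c_gt0 a_gt0 phi0 phi1 phi_eq phi_l2 1.
have vE := ac_density_dirac (ltW c0) (spectral_measure_fin nuP)
  (dc_spectral_measure a_gt0 phi0 phi1 phi_eq phi_l2 sum_b sum_a sum_bt sum_at nuP nutP)
  vP vtP.
split; first exact: class_W_scale c0 vE.
(* The almost everywhere relation is solved for [vt], with the positive factor [1 / c_1]. *)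
apply: (@class_W_scale _ _ _ (dc_c phi 1)^-1); first by rewrite invr_gt0.
by apply: filterS vE => x ->; rewrite mulKf// gt_eqF.
Qed.
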